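(* Let $q\in\mathbb C$ with $q\neq 0$, $|q|\neq 1$, let $r,s\in\mathbb Z$ with $r\neq -1$, let $\lambda\in\mathbb C$, $\lambda\ne 0$, and let $\eta\in\mathbb C$ satisfy $\eta^{r^2+r+1}=\lambda^{-r}$. Let $Q_q(3)$, the matrices $T_s,\tilde T_s$, the quantum exponential $\langle\,\cdot\,\rangle_{q^{r+1}}$ and the formal element $\mathsf F$ be as in the context, and put $$w^{(s)} = a_1^{r-s} a_2^{s-r}\, b_1 b_3^{-1} a_3^{s+1},\qquad \tilde w^{(s)} = a_3^{s-r}\, b_1 b_3^{-1} a_1^{-s-1} a_2^{s+1}.$$ Then for every invertible formal power series $f\in\mathbb C[[t]]$ (which may depend on $q$ and $\lambda$) the element $$\mathsf R^{(s)}(\lambda)= f\bigl(\tilde w^{(s)}\bigr)\,\bigl\langle \lambda\, w^{(s)}\bigr\rangle_{q^{r+1}}\,\mathsf F=\mathsf F\, f\bigl(w^{(s)}\bigr)\,\bigl\langle \lambda\,\tilde w^{(s)}\bigr\rangle_{q^{r+1}}$$ (the two expressions being equal) satisfies $$\mathsf R^{(s)}(\lambda)\,T_s=\tilde T_s\,\mathsf R^{(s)}(\lambda),$$ where the products with the matrices are taken entry-wise.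
   Context: $Q_q(3)$ is the associative unital $\mathbb C$-algebra with generators $a_i^{\pm1},b_i^{\pm1}$, $i=1,2,3$, and relations $a_ib_j=q^{\delta_{ij}}b_ja_i$, $a_ia_j=a_ja_i$, $b_ib_j=b_jb_i$, $a_ia_i^{-1}=a_i^{-1}a_i=1$, $b_ib_i^{-1}=b_i^{-1}b_i=1$. For $p\in\mathbb C$ nonzero with $|p|\ne1$, $\langle x\rangle_p=\sum_{n\ge 0}\frac{(-x)^n}{(1-p)(1-p^2)\cdots(1-p^n)}$ is a formal power series in $x$ (the $n=0$ term is $1$). Define $3\times3$ matrices over $Q_q(3)$: $$T = \eta \begin{pmatrix} a_1 & b_1 & 0\\ 0& a^{-r}_1 &0 \\ 0&0& 1\end{pmatrix}\begin{pmatrix} 1 &0&0 \\0 & a_2 & b_2 \\ 0&0& a^{-r}_2 \end{pmatrix}\begin{pmatrix}1 & 0 &0 \\ 0& \lambda &0 \\ 0&0& 1\end{pmatrix}\begin{pmatrix} a_3 & b_3 & 0\\ 0& a^{-r}_3 &0 \\ 0&0& 1\end{pmatrix},$$ $$\tilde T = \eta \begin{pmatrix} 1 &0&0 \\ 0& a_3 & b_3 \\ 0&0& a^{-r}_3 \end{pmatrix}\begin{pmatrix}1 & 0 &0 \\ 0& \lambda &0 \\ 0&0& 1\end{pmatrix}\begin{pmatrix} a_2 & b_2 & 0\\ 0& a^{-r}_2 &0 \\ 0&0& 1\end{pmatrix}\begin{pmatrix} 1 &0&0 \\ 0& a_1 & b_1 \\ 0&0& a^{-r}_1 \end{pmatrix}.$$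 $\psi_s$ is the automorphism of $Q_q(3)$ with $\psi_s(a_i)=a_i$ ($i=1,2,3$), $\psi_s(b_1)=a_2^sa_3^s b_1$, $\psi_s(b_2)=a_1^s b_2$, $\psi_s(b_3)=a_1^s b_3$. Put $T_s=\psi_s(T)$ and $\tilde T_s=\psi_s(\tilde T)$, applied entry-wise. $\mathcal F$ is the involutive automorphism of $Q_q(3)$ with $\mathcal F(a_1)=a_1$, $\mathcal F(a_2)=a_1a_3$, $\mathcal F(a_3)=a_1^{-1}a_2$, $\mathcal F(b_1)=b_1b_2b_3^{-1}$, $\mathcal F(b_2)=b_3$, $\mathcal F(b_3)=b_2$. The formal element $\mathsf F$ satisfies $\mathsf F^2=1$ and $\mathsf F\,x=\mathcal F(x)\,\mathsf F$ for all $x\in Q_q(3)$. Formal conventions: one works with formal (possibly infinite) $\mathbb C$-linear combinations of the elements $M$ and $M\mathsf F$, where $M$ runs over the monomial basis $a_1^{i_1}a_2^{i_2}a_3^{i_3}b_1^{j_1}b_2^{j_2}b_3^{j_3}$ of $Q_q(3)$; products are computed termwise whenever each basis element receives finitely many contributions. The monomials $w^{(s)}$ and $\tilde w^{(s)}$ commute and are algebraically independent, so all products above are well defined. *)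

(* Defs.v *)
From HB Require Import structures.
From mathcomp Require Import all_boot all_order all_algebra.
From mathcomp Require Import finmap complex monalg.
From mathcomp Require Import boolp classical_sets functions cardinality fsbigop.
From mathcomp Require Import reals ring.

Set Implicit Arguments.
Unset Strict Implicit.
Unset Printing Implicit Defensive.

Import Order.TTheory GRing.Theory Num.Theory.
Local Open Scope ring_scope.

Section LinearExtension.
Variables (K : choiceType) (F : fieldType) (V : lmodType F).
Implicit Types (h : K -> V) (x y : {malg F[K]}).

Definition lext h x : V := \sum_(u <- msupp x) x@_u *: h u.

Lemma lextEw (d : {fset K}) h x :
  (msupp x `<=` d)%fset -> lext h x = \sum_(u <- d) x@_u *: h u.
Proof.
move=> le_d; rewrite /lext (big_fset_incl _ le_d) //= => u _ /mcoeff_outdom->.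
by rewrite scale0r.
Qed.

Lemma lext_is_linear h : linear (lext h).
Proof.
move=> c x y; set d := (msupp x `|` msupp y)%fset.
rewrite (@lextEw d _ x) ?fsubsetUl // (@lextEw d _ y) ?fsubsetUr //.
rewrite (@lextEw d); last first.
  apply/fsubsetP => u /(fsubsetP (msuppD_le _ _)); rewrite !inE => /orP[|->].
    by move/(fsubsetP (msuppZ_le _ _)) ->.
  by rewrite orbT.
rewrite scaler_sumr -big_split; apply: eq_bigr => u _ /=.
by rewrite mcoeffD mcoeffZ scalerDl scalerA.
Qed.

HB.instance Definition _ h :=
  GRing.isLinear.Build F {malg F[K]} V *:%R (lext h) (lext_is_linear h).

Lemma lextU h c u : lext h << c *g u >> = c *: h u.
Proof. by rewrite (lextEw _ msuppU_le) big_seq_fset1 mcoeffUU. Qed.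

Lemma eq_lext h h' x : h =1 h' -> lext h x = lext h' x.
Proof. by move=> e; apply: eq_bigr => u _; rewrite e. Qed.

Lemma lext_comp (W : lmodType F) (g : {linear V -> W}) h x :
  g (lext h x) = \sum_(u <- msupp x) x@_u *: g (h u).
Proof. by rewrite linear_sum; apply: eq_bigr => u _; rewrite linearZ. Qed.

End LinearExtension.

(* (i, j) : idx stands for a_1^i_1 a_2^i_2 a_3^i_3 b_1^j_1 b_2^j_2 b_3^j_3; the
   indices 1, 2, 3 are the elements 0, 1, 2 of 'I_3. *)
Notation idx := ({ffun 'I_3 -> int} * {ffun 'I_3 -> int})%type.

Definition dot (j i : {ffun 'I_3 -> int}) : int := \sum_k j k * i k.

Lemma dotDl j j' i : dot (j + j') i = dot j i + dot j' i.
Proof. by rewrite -big_split; apply: eq_bigr => k _; rewrite ffunE mulrDl. Qed.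

Lemma dotDr j i i' : dot j (i + i') = dot j i + dot j i'.
Proof. by rewrite -big_split; apply: eq_bigr => k _; rewrite ffunE mulrDr. Qed.

Lemma dot0l i : dot 0 i = 0.
Proof. by apply: big1 => k _; rewrite ffunE mul0r. Qed.

Lemma dot0r j : dot j 0 = 0.
Proof. by apply: big1 => k _; rewrite ffunE mulr0. Qed.

HB.lock Definition mon (F : fieldType) (u : idx) : {malg F[idx]} := << u >>.

(* Since b_k a_k = q^-1 a_k b_k, reordering a^i b^j a^i' b^j' into
   a^(i + i') b^(j + j') costs q^(- sum_k j_k i'_k). *)
HB.lock Definition qmul (F : fieldType) (q : F) (x y : {malg F[idx]}) :=
  lext (fun u => lext (fun v => q ^ (- dot u.2 v.1) *: mon F (u + v)) y) x.

Section QuantumTorus.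
Variables (F : fieldType) (q : F) (q0 : q != 0).
Local Notation P := {malg F[idx]}.

Local Notation mon := (@mon F).
Local Notation qmul := (qmul q).

Lemma monE (c : F) u : << c *g u >> = c *: mon u :> P.
Proof.
rewrite mon.unlock; apply/malgP => v.
by rewrite mcoeffZ [in LHS]mcoeffU [in RHS]mcoeffU mulrnAr mulr1.
Qed.

Lemma malg_monE (x : P) : x = \sum_(u <- msupp x) x@_u *: mon u.
Proof. by rewrite {1}[x]monalgE; apply: eq_bigr => u _; rewrite monE. Qed.

Lemma malg_ind (C : P -> Prop) :
  (forall c x y, C x -> C y -> C (c *: x + y)) -> C 0 ->
  (forall u, C (mon u)) -> forall x, C x.
Proof.
move=> CD C0 Cm x; rewrite [x]malg_monE.
elim/big_rec: _ => // u y _ Cy; exact: CD.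
Qed.

Lemma lext_mon (V : lmodType F) (h : idx -> V) u : lext h (mon u) = h u.
Proof. by rewrite mon.unlock lextU scale1r. Qed.

Lemma qmulDl : left_distributive qmul +%R.
Proof. by move=> x y z; rewrite qmul.unlock linearD. Qed.

Lemma qmulDr : right_distributive qmul +%R.
Proof.
move=> x y z; rewrite qmul.unlock /lext -big_split /=; apply: eq_bigr => u _.
by rewrite -scalerDr -[RHS]/(_ *: (lext _ _ + lext _ _)) -linearD.
Qed.

Lemma qmulZl c x y : qmul (c *: x) y = c *: qmul x y.
Proof. by rewrite qmul.unlock linearZ. Qed.

Lemma qmulZr c x y : qmul x (c *: y) = c *: qmul x y.
Proof.
rewrite qmul.unlock scaler_sumr; apply: eq_bigr => u _.
by rewrite linearZ /= !scalerA mulrC.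
Qed.

Lemma qmul0l y : qmul 0 y = 0. Proof. by rewrite qmul.unlock linear0. Qed.

Lemma qmul0r x : qmul x 0 = 0.
Proof. by have := qmulZr 0 x 0; rewrite !scale0r. Qed.

Lemma qmul_mon u v : qmul (mon u) (mon v) = q ^ (- dot u.2 v.1) *: mon (u + v).
Proof. by rewrite qmul.unlock !lext_mon. Qed.

Lemma qmulA : associative qmul.
Proof.
move=> x y z; elim/malg_ind: x => [c x x' ex ex'||u].
- by rewrite !(qmulDl, qmulZl) ex ex'.
- by rewrite !qmul0l.
elim/malg_ind: y => [c y y' ey ey'||v].
- rewrite (qmulDr (mon u)) (qmulZr _ (mon u)) qmulDl qmulZl.
  by rewrite (qmulDl _ _ z) (qmulZl _ _ z) qmulDr qmulZr ey ey'.
- by rewrite qmul0r !qmul0l qmul0r.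
elim/malg_ind: z => [c z z' ez ez'||w].
- rewrite (qmulDr (mon v)) (qmulZr _ (mon v)) !(qmulDr _ (_ *: _)) !qmulZr.
  by rewrite ez ez'.
- by rewrite !qmul0r.
rewrite (qmul_mon u v) (qmul_mon v w) qmulZl qmulZr.
rewrite (qmul_mon u (v + w)) (qmul_mon (u + v) w).
rewrite !scalerA (addrA u v w) -(expfzDr _ _ q0) -(expfzDr _ _ q0).
rewrite dotDl dotDr !opprD [- dot v.2 _ + _]addrC -!addrA.
by rewrite [- dot u.2 w.1 + _]addrC.
Qed.

Lemma qmul1l : left_id (mon 0) qmul.
Proof.
elim/malg_ind => [c x y ex ey||u]; first by rewrite qmulDr qmulZr ex ey.
  by rewrite qmul0r.
by rewrite qmul_mon dot0l oppr0 expr0z scale1r add0r.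
Qed.

Lemma qmul1r : right_id (mon 0) qmul.
Proof.
elim/malg_ind => [c x y ex ey||u]; first by rewrite qmulDl qmulZl ex ey.
  by rewrite qmul0l.
by rewrite qmul_mon dot0r oppr0 expr0z scale1r addr0.
Qed.

Lemma mon_neq0 u : mon u != 0.
Proof. by rewrite mon.unlock monalgU_eq0 oner_eq0. Qed.

End QuantumTorus.

(* The algebra Q_q(3), realised on its monomial basis. That it has the required
   presentation is qab, qaC, qbC (relations between the generators qa, qb) with
   qsubst_monoid_morphism, qsubst_qa, qsubst_qb and qsubst_unique (universal
   property); qmon_gen identifies the basis. *)
Definition qtorus (F : fieldType) (q : F) (q0 : q != 0) : predArgType :=
  {malg F[idx]}.

Section QuantumTorusAlgebra.
Variables (F : fieldType) (q : F) (q0 : q != 0).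
Local Notation Q := (qtorus q0).

HB.instance Definition _ := GRing.Lmodule.on Q.
HB.instance Definition _ := GRing.Zmodule_isNzRing.Build Q
  (qmulA q0) (@qmul1l _ q) (@qmul1r _ q) (@qmulDl _ q) (@qmulDr _ q)
  (mon_neq0 F 0).

Lemma qtorus_scaleAl (c : F) (x y : Q) : c *: (x * y) = c *: x * y.
Proof. by rewrite [in RHS]/GRing.mul/= qmulZl. Qed.

Lemma qtorus_scaleAr (c : F) (x y : Q) : c *: (x * y) = x * (c *: y).
Proof. by rewrite [in RHS]/GRing.mul/= qmulZr. Qed.

HB.instance Definition _ := GRing.Lmodule_isLalgebra.Build F Q qtorus_scaleAl.
HB.instance Definition _ := GRing.Lalgebra_isAlgebra.Build F Q qtorus_scaleAr.

(* Units and inverses are classical: x is invertible when it has a two-sided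
   inverse. *)
Definition qunit : pred Q := fun x => `[< exists y, y * x = 1 /\ x * y = 1 >].

Definition qinv (x : Q) : Q :=
  if pselect (exists y, y * x = 1 /\ x * y = 1) is left h then projT1 (cid h)
  else x.

Lemma qmulVr : {in qunit, left_inverse 1 qinv *%R}.
Proof.
by move=> x /asboolP h; rewrite /qinv; case: pselect => // k; case: cid => y [].
Qed.

Lemma qdivrr : {in qunit, right_inverse 1 qinv *%R}.
Proof.
by move=> x /asboolP h; rewrite /qinv; case: pselect => // k; case: cid => y [].
Qed.

Lemma qunitP (x y : Q) : y * x = 1 /\ x * y = 1 -> qunit x.
Proof. by move=> h; apply/asboolP; exists y. Qed.

Lemma qinv_out : {in [predC qunit], qinv =1 id}.
Proof. by move=> x /asboolP h; rewrite /qinv; case: pselect. Qed.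

HB.instance Definition _ := GRing.NzRing_hasMulInverse.Build Q
  qmulVr qdivrr qunitP qinv_out.
HB.instance Definition _ := GRing.UnitAlgebra.on Q.

Definition qmon (u : idx) : Q := mon F u.

Lemma qmonM u v : qmon u * qmon v = q ^ (- dot u.2 v.1) *: qmon (u + v).
Proof. exact: qmul_mon. Qed.

Lemma qmon0 : qmon 0 = 1. Proof. by []. Qed.

Lemma qtorus_ind (C : Q -> Prop) :
  (forall c x y, C x -> C y -> C (c *: x + y)) -> C 0 ->
  (forall u, C (qmon u)) -> forall x, C x.
Proof. exact: malg_ind. Qed.

Lemma qmon_unit u : qmon u \is a GRing.unit.
Proof.
apply/unitrP; exists (q ^ (- dot u.2 u.1) *: qmon (- u)).
have dotN : dot (- u.2) u.1 = - dot u.2 u.1.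
  by apply/eqP; rewrite -addr_eq0 -dotDl addNr dot0l.
have dotN' : dot u.2 (- u.1) = - dot u.2 u.1.
  by apply/eqP; rewrite -addr_eq0 -dotDr addNr dot0r.
rewrite -scalerAl -scalerAr !qmonM dotN dotN' !opprK subrr addNr.
by rewrite scalerA -expfzDr // addNr expr0z scale1r qmon0.
Qed.

Definition qa (i : 'I_3) : Q := qmon ([ffun k => (k == i)%:R], 0).
Definition qb (i : 'I_3) : Q := qmon (0, [ffun k => (k == i)%:R]).

Lemma qa_unit i : qa i \is a GRing.unit. Proof. exact: qmon_unit. Qed.
Lemma qb_unit i : qb i \is a GRing.unit. Proof. exact: qmon_unit. Qed.

Lemma qaC i j : qa i * qa j = qa j * qa i.
Proof. by rewrite /qa !qmonM /= !dot0l addrC. Qed.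

Lemma qbC i j : qb i * qb j = qb j * qb i.
Proof. by rewrite /qb !qmonM /= !dot0r addrC. Qed.

Lemma qab i j : qa i * qb j = q ^+ (i == j) *: (qb j * qa i).
Proof.
rewrite /qa /qb (qmonM (_, 0)) (qmonM (0, _)) scalerA /=.
rewrite dot0l oppr0 expr0z (addrC (_, 0)).
suff -> : dot [ffun k => (k == j)%:R] [ffun k => (k == i)%:R] = (i == j)%:Z.
  by rewrite -[q ^+ _]/(q ^ (i == j)%:Z) -(expfzDr _ _ q0) subrr expr0z scale1r.
rewrite /dot (bigD1 j) //= big1 => [|k /negPf kj]; last first.
  by rewrite !ffunE kj mul0r.
by rewrite addr0 !ffunE eqxx mul1r eq_sym natz.
Qed.

Lemma qaXz k (n : int) : qa k ^ n = qmon ([ffun l => (l == k)%:R * n], 0).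
Proof.
have eN (m : nat) : qa k ^+ m = qmon ([ffun l => (l == k)%:R * m%:Z], 0).
  elim: m => [|m IHm].
    rewrite expr0 -qmon0; congr (qmon (_, _)).
    by apply/ffunP => l; rewrite !ffunE mulr0.
  rewrite exprS IHm /qa qmonM dot0l oppr0 expr0z scale1r; congr (qmon (_, _)).
    by apply/ffunP => l; rewrite !ffunE intS mulrDr mulr1.
  by rewrite addr0.
case: n => m; first exact: eN.
rewrite NegzE -[LHS]/((qa k ^+ m.+1)^-1) eN.
apply: (mulrI (qmon_unit ([ffun l => (l == k)%:R * m.+1%:Z], 0))).
rewrite divrr ?qmon_unit // qmonM dot0l oppr0 expr0z scale1r -qmon0.
congr (qmon (_, _)); last by rewrite addr0.
by apply/ffunP => l; rewrite !ffunE mulrN subrr.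
Qed.

Lemma qbXz k (n : int) : qb k ^ n = qmon (0, [ffun l => (l == k)%:R * n]).
Proof.
have eN (m : nat) : qb k ^+ m = qmon (0, [ffun l => (l == k)%:R * m%:Z]).
  elim: m => [|m IHm].
    rewrite expr0 -qmon0; congr (qmon (_, _)).
    by apply/ffunP => l; rewrite !ffunE mulr0.
  rewrite exprS IHm /qb qmonM dot0r oppr0 expr0z scale1r; congr (qmon (_, _)).
    by rewrite addr0.
  by apply/ffunP => l; rewrite !ffunE intS mulrDr mulr1.
case: n => m; first exact: eN.
rewrite NegzE -[LHS]/((qb k ^+ m.+1)^-1) eN.
apply: (mulrI (qmon_unit (0, [ffun l => (l == k)%:R * m.+1%:Z]))).
rewrite divrr ?qmon_unit // qmonM dot0r oppr0 expr0z scale1r -qmon0.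
congr (qmon (_, _)); first by rewrite addr0.
by apply/ffunP => l; rewrite !ffunE mulrN subrr.
Qed.

Lemma sum_delta (i : {ffun 'I_3 -> int}) :
  \sum_k [ffun l => (l == k)%:R * i k] = i.
Proof.
apply/ffunP => l; rewrite sum_ffunE (bigD1 l) //= big1 => [|k /negPf kl].
  by rewrite addr0 !ffunE eqxx mul1r.
by rewrite !ffunE eq_sym kl mul0r.
Qed.

Lemma qmon_l (i : {ffun 'I_3 -> int}) : qmon (i, 0) = \prod_k qa k ^ i k.
Proof.
rewrite -[in LHS](sum_delta i); elim: (index_enum _) => [|k t IHt].
  by rewrite !big_nil -qmon0.
rewrite !big_cons -IHt qaXz qmonM dot0l oppr0 expr0z scale1r.
by congr (qmon (_, _)); rewrite addr0.
Qed.

Lemma qmon_r (j : {ffun 'I_3 -> int}) : qmon (0, j) = \prod_k qb k ^ j k.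
Proof.
rewrite -[in LHS](sum_delta j); elim: (index_enum _) => [|k t IHt].
  by rewrite !big_nil -qmon0.
rewrite !big_cons -IHt qbXz qmonM dot0r oppr0 expr0z scale1r.
by congr (qmon (_, _)); rewrite addr0.
Qed.

Lemma qmon_gen u : qmon u = (\prod_k qa k ^ u.1 k) * \prod_k qb k ^ u.2 k.
Proof.
rewrite -qmon_l -qmon_r qmonM dot0l oppr0 expr0z scale1r; case: u => i j /=.
by congr (qmon (_, _)); rewrite ?addr0 ?add0r.
Qed.

End QuantumTorusAlgebra.

Section Substitution.
Variables (F : fieldType) (q : F) (q0 : q != 0) (A : unitAlgType F).
Local Notation Q := (qtorus q0).
Implicit Types (x y : 'I_3 -> A).

Definition qsubst_mon x y (u : idx) : A :=
  (\prod_k x k ^ u.1 k) * \prod_k y k ^ u.2 k.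

Definition qsubst x y : Q -> A := lext (qsubst_mon x y).

HB.instance Definition _ x y := GRing.Linear.on (qsubst x y).

Definition qrelations x y :=
  [/\ forall k, x k \is a GRing.unit, forall k, y k \is a GRing.unit,
      forall k l, x k * x l = x l * x k, forall k l, y k * y l = y l * y k &
      forall k l, x k * y l = q ^+ (k == l) *: (y l * x k)].

Lemma scaler_swap (c : F) (a b : A) :
  c != 0 -> a = c *: b -> b = c^-1 *: a.
Proof. by move=> c0 ->; rewrite scalerA mulVf // scale1r. Qed.

Lemma qcommXz (c : F) (a b : A) (n : int) : c != 0 -> b \is a GRing.unit ->
  a * b = c *: (b * a) -> a * b ^ n = c ^ n *: (b ^ n * a).
Proof.
move=> c0 ub ab.
have abN (m : nat) : a * b ^+ m = c ^+ m *: (b ^+ m * a).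
  elim: m => [|m IHm]; first by rewrite !expr0 mul1r mulr1 scale1r.
  rewrite exprS mulrA ab -scalerAl -(mulrA b a) IHm -scalerAr scalerA mulrA.
  by rewrite -!exprS.
case: n => m; first exact: abN.
rewrite NegzE -[b ^ _]/((b ^+ m.+1)^-1) -[c ^ _]/((c ^+ m.+1)^-1).
have ubm : b ^+ m.+1 \is a GRing.unit by rewrite unitrX.
apply: scaler_swap; first by rewrite expf_neq0.
apply: (mulIr ubm); rewrite -[LHS]mulrA -scalerAl -[in RHS]mulrA mulVr // mulr1.
by rewrite abN -scalerAr mulKr.
Qed.

Lemma prod_qcomm (c : 'I_3 -> F) (a : A) (y : 'I_3 -> A) :
  (forall k, a * y k = c k *: (y k * a)) ->
  a * \prod_k y k = (\prod_k c k) *: (\prod_k y k * a).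
Proof.
move=> ay; elim: (index_enum _) => [|k t IHt].
  by rewrite !big_nil mul1r mulr1 scale1r.
by rewrite !big_cons mulrA ay -scalerAl -(mulrA (y k) a) IHt -scalerAr scalerA mulrA.
Qed.

Lemma prodXzD (x : 'I_3 -> A) (i j : {ffun 'I_3 -> int}) :
  (forall k, x k \is a GRing.unit) -> (forall k l, x k * x l = x l * x k) ->
  \prod_k x k ^ (i + j) k = (\prod_k x k ^ i k) * \prod_k x k ^ j k.
Proof.
move=> ux xC; rewrite -prodrM_comm => [|k l _ _].
  by apply: eq_bigr => k _; rewrite ffunE exprzDr.
by apply/commrXz/commr_sym/commrXz/xC.
Qed.

Lemma qsubst_monM x y u v : qrelations x y ->
  qsubst_mon x y u * qsubst_mon x y v
  = q ^ (- dot u.2 v.1) *: qsubst_mon x y (u + v).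
Proof.
move=> [ux uy xC yC xy].
have xyE k n : \prod_l x l ^ v.1 l * y k ^ n
               = q ^ (v.1 k * n) *: (y k ^ n * \prod_l x l ^ v.1 l).
  have yx l : y k * x l = q ^- (k == l) *: (x l * y k).
    by apply: scaler_swap; rewrite ?expf_neq0 // xy eq_sym.
  have yX l : y k * x l ^ v.1 l = (q ^- (k == l)) ^ v.1 l *: (x l ^ v.1 l * y k).
    by apply: qcommXz (yx l); rewrite ?invr_eq0 ?expf_neq0.
  have Xy : \prod_l x l ^ v.1 l * y k = q ^ v.1 k *: (y k * \prod_l x l ^ v.1 l).
    have -> : q ^ v.1 k = (\prod_l (q ^- (k == l)) ^ v.1 l)^-1.
      rewrite (bigD1 k) //= big1 => [|l lk]; last first.
        by rewrite eq_sym (negPf lk) expr0 invr1 exp1rz.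
      by rewrite eqxx expr1 mulr1 expfV invrK.
    apply: scaler_swap (prod_qcomm yX).
    by apply/prodf_neq0 => l _; rewrite expfz_neq0 // invr_eq0 expf_neq0.
  by rewrite -exprz_exp; apply: qcommXz => //; rewrite expfz_neq0.
have YX : \prod_l y l ^ u.2 l * \prod_l x l ^ v.1 l
       = q ^ (- dot u.2 v.1) *: (\prod_l x l ^ v.1 l * \prod_l y l ^ u.2 l).
  rewrite (prod_qcomm (fun k => xyE k (u.2 k))) scalerA.
  rewrite (_ : \prod_k _ = q ^ dot u.2 v.1); last first.
    rewrite /dot; elim: (index_enum _) => [|k t IHt]; first by rewrite !big_nil.
    by rewrite !big_cons expfzDr // IHt mulrC [v.1 k * _]mulrC mulrC.
  by rewrite -expfzDr // addNr scale1r.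
rewrite /qsubst_mon mulrA -(mulrA (\prod_k x k ^ u.1 k)) YX.
rewrite -scalerAr -!scalerAl; congr (_ *: _).
by rewrite !prodXzD // !mulrA.
Qed.

Lemma qsubst_qmon x y u : qsubst x y (qmon q0 u) = qsubst_mon x y u.
Proof. exact: lext_mon. Qed.

Lemma qsubst_monoid_morphism x y :
  qrelations x y -> monoid_morphism (qsubst x y).
Proof.
move=> xyP; split=> [|u v].
  rewrite -qmon0 qsubst_qmon /qsubst_mon.
  by rewrite !big1 ?mulr1 // => k _; rewrite ffunE expr0z.
elim/qtorus_ind: u => [c u u' eu eu'||u].
- by rewrite mulrDl -scalerAl !linearP /= eu eu' mulrDl -scalerAl.
- by rewrite mul0r !linear0 mul0r.
elim/qtorus_ind: v => [c v v' ev ev'||v].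
- by rewrite mulrDr -scalerAr !linearP /= ev ev' mulrDr -scalerAr.
- by rewrite mulr0 !linear0 mulr0.
by rewrite qmonM linearZ /= !qsubst_qmon qsubst_monM.
Qed.

Lemma prodXz_delta (x : 'I_3 -> A) k :
  \prod_l x l ^ [ffun l => (l == k)%:R : int] l = x k.
Proof.
rewrite (eq_bigr (fun l => if l == k then x l else 1)) => [|l _].
  by rewrite -big_mkcond big_pred1_eq.
by rewrite ffunE; case: eqP.
Qed.

Lemma qsubst_qa x y k : qsubst x y (qa q0 k) = x k.
Proof.
rewrite qsubst_qmon /qsubst_mon /= prodXz_delta big1 ?mulr1 // => l _.
by rewrite ffunE expr0z.
Qed.

Lemma qsubst_qb x y k : qsubst x y (qb q0 k) = y k.
Proof.
rewrite qsubst_qmon /qsubst_mon /= prodXz_delta big1 ?mul1r // => l _.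
by rewrite ffunE expr0z.
Qed.

Lemma qsubst_unique x y (g : {lrmorphism Q -> A}) :
  (forall k, g (qa q0 k) = x k) -> (forall k, g (qb q0 k) = y k) ->
  g =1 qsubst x y.
Proof.
move=> ga gb; elim/qtorus_ind => [c u v eu ev||u].
- by rewrite !linearP /= eu ev.
- by rewrite !linear0.
rewrite qsubst_qmon qmon_gen rmorphM !rmorph_prod; congr (_ * _).
  by apply: eq_bigr => k _; rewrite rmorphXz ?qa_unit //= ga.
by apply: eq_bigr => k _; rewrite rmorphXz ?qb_unit //= gb.
Qed.

End Substitution.

Section Automorphisms.
Variables (F : fieldType) (q : F) (q0 : q != 0).
Local Notation Q := (qtorus q0).
Local Notation a1 := (qa q0 0).
Local Notation a2 := (qa q0 1).
Local Notation a3 := (qa q0 2).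
Local Notation b1 := (qb q0 0).
Local Notation b2 := (qb q0 1).
Local Notation b3 := (qb q0 2).

Definition triple (x1 x2 x3 : Q) (k : 'I_3) : Q := nth 0 [:: x1; x2; x3] k.

Definition psi (s : int) : Q -> Q :=
  qsubst (triple a1 a2 a3)
         (triple (a2 ^ s * a3 ^ s * b1) (a1 ^ s * b2) (a1 ^ s * b3)).

Definition calF : Q -> Q :=
  qsubst (triple a1 (a1 * a3) (a1^-1 * a2)) (triple (b1 * b2 * b3^-1) b3 b2).

Definition vec (n1 n2 n3 : int) : {ffun 'I_3 -> int} :=
  [ffun k : 'I_3 => [:: n1; n2; n3]`_k].

Lemma dot_vec m1 m2 m3 n1 n2 n3 :
  dot (vec m1 m2 m3) (vec n1 n2 n3) = m1 * n1 + m2 * n2 + m3 * n3.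
Proof. by rewrite /dot !big_ord_recl big_ord0 !ffunE /= addr0 addrA. Qed.

Lemma ord3P (C : 'I_3 -> Prop) : C 0 -> C 1 -> C 2 -> forall k, C k.
Proof.
move=> C0 C1 C2 [[|[|[|//]]] lk].
- by rewrite (_ : Ordinal lk = 0) //; apply/val_inj.
- by rewrite (_ : Ordinal lk = 1) //; apply/val_inj.
- by rewrite (_ : Ordinal lk = 2) //; apply/val_inj.
Qed.

Lemma prod_vec (x : 'I_3 -> Q) n1 n2 n3 :
  \prod_k x k ^ vec n1 n2 n3 k = x 0 ^ n1 * x 1 ^ n2 * x 2 ^ n3.
Proof.
rewrite !big_ord_recl big_ord0 mulr1 mulrA !ffunE /=.
by congr (x _ ^ _ * x _ ^ _ * x _ ^ _); apply/val_inj.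
Qed.

Lemma qmon_vec n1 n2 n3 m1 m2 m3 :
  qmon q0 (vec n1 n2 n3, vec m1 m2 m3)
  = a1 ^ n1 * a2 ^ n2 * a3 ^ n3 * (b1 ^ m1 * b2 ^ m2 * b3 ^ m3).
Proof. by rewrite qmon_gen !prod_vec. Qed.

Lemma qrelations_mon (u v : 'I_3 -> idx) :
  (forall k l, dot (u k).2 (u l).1 = dot (u l).2 (u k).1) ->
  (forall k l, dot (v k).2 (v l).1 = dot (v l).2 (v k).1) ->
  (forall k l, dot (v l).2 (u k).1 = (k == l)%:Z + dot (u k).2 (v l).1) ->
  qrelations q (fun k => qmon q0 (u k)) (fun k => qmon q0 (v k)).
Proof.
move=> uC vC uv; split=> [k|k|k l|k l|k l]; rewrite ?qmon_unit //.
- by rewrite !qmonM uC addrC.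
- by rewrite !qmonM vC addrC.
rewrite !qmonM scalerA uv -[q ^+ _]/(q ^ (k == l)%:Z) -(expfzDr _ _ q0).
by rewrite opprD addNKr addrC.
Qed.

Definition idx_triple (u1 u2 u3 : idx) (k : 'I_3) : idx := nth 0 [:: u1; u2; u3] k.

Lemma psi_relations s :
  qrelations q (triple a1 a2 a3)
    (triple (a2 ^ s * a3 ^ s * b1) (a1 ^ s * b2) (a1 ^ s * b3)).
Proof.
pose u := idx_triple (vec 1 0 0, vec 0 0 0) (vec 0 1 0, vec 0 0 0)
                     (vec 0 0 1, vec 0 0 0).
pose v := idx_triple (vec 0 s s, vec 1 0 0) (vec s 0 0, vec 0 1 0)
                     (vec s 0 0, vec 0 0 1).
have -> : triple a1 a2 a3 = fun k => qmon q0 (u k).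
  by apply/funext; apply: ord3P; rewrite qmon_vec !(expr0z, expr1z, mul1r, mulr1).
have -> : triple (a2 ^ s * a3 ^ s * b1) (a1 ^ s * b2) (a1 ^ s * b3)
          = fun k => qmon q0 (v k).
  by apply/funext; apply: ord3P; rewrite qmon_vec !(expr0z, expr1z, mul1r, mulr1).
by apply: qrelations_mon; do 2!apply: ord3P; rewrite /u /v /idx_triple /= !dot_vec; ring.
Qed.

Lemma calF_relations :
  qrelations q (triple a1 (a1 * a3) (a1^-1 * a2)) (triple (b1 * b2 * b3^-1) b3 b2).
Proof.
pose u := idx_triple (vec 1 0 0, vec 0 0 0) (vec 1 0 1, vec 0 0 0)
                     (vec (-1) 1 0, vec 0 0 0).
pose v := idx_triple (vec 0 0 0, vec 1 1 (-1)) (vec 0 0 0, vec 0 0 1)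
                     (vec 0 0 0, vec 0 1 0).
have -> : triple a1 (a1 * a3) (a1^-1 * a2) = fun k => qmon q0 (u k).
  by apply/funext; apply: ord3P; rewrite qmon_vec !(expr0z, expr1z, mul1r, mulr1) ?exprN1.
have -> : triple (b1 * b2 * b3^-1) b3 b2 = fun k => qmon q0 (v k).
  by apply/funext; apply: ord3P; rewrite qmon_vec !(expr0z, expr1z, mul1r, mulr1) ?exprN1.
by apply: qrelations_mon; do 2!apply: ord3P; rewrite /u /v /idx_triple /= !dot_vec; ring.
Qed.

HB.instance Definition _ s := GRing.Linear.on (psi s).
HB.instance Definition _ s := GRing.isMonoidMorphism.Build Q Q (psi s)
  (qsubst_monoid_morphism q0 (psi_relations s)).

HB.instance Definition _ := GRing.Linear.on calF.
HB.instance Definition _ := GRing.isMonoidMorphism.Build Q Q calF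
  (qsubst_monoid_morphism q0 calF_relations).

Lemma qtorus_lrmorphism_id (g : {lrmorphism Q -> Q}) :
  (forall k, g (qa q0 k) = qa q0 k) -> (forall k, g (qb q0 k) = qb q0 k) ->
  g =1 id.
Proof.
move=> ga gb x; rewrite (qsubst_unique ga gb).
by rewrite -(@qsubst_unique _ _ q0 _ _ _ idfun).
Qed.

Lemma psi_a s k : psi s (qa q0 k) = qa q0 k.
Proof. by rewrite [LHS]qsubst_qa; move: k; apply: ord3P. Qed.

Lemma psi_b1 s : psi s b1 = a2 ^ s * a3 ^ s * b1.
Proof. exact: qsubst_qb. Qed.

Lemma psi_b2 s : psi s b2 = a1 ^ s * b2.
Proof. exact: qsubst_qb. Qed.

Lemma psi_b3 s : psi s b3 = a1 ^ s * b3.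
Proof. exact: qsubst_qb. Qed.

Lemma psi_aXz s k n : psi s (qa q0 k ^ n) = qa q0 k ^ n.
Proof. by rewrite rmorphXz ?qa_unit //= psi_a. Qed.

Lemma psiNK s : cancel (psi s) (psi (- s)).
Proof.
have aK k (x : Q) : qa q0 k ^ s * (qa q0 k ^ (- s) * x) = x.
  by rewrite mulrA -exprzDr ?qa_unit // subrr expr0z mul1r.
have aC : a3 ^ s * a2 ^ (- s) = a2 ^ (- s) * a3 ^ s.
  by apply/commrXz/commr_sym/commrXz; rewrite /GRing.comm qaC.
apply: (@qtorus_lrmorphism_id (psi (- s) \o psi s)); apply: ord3P => /=.
- by rewrite !psi_a.
- by rewrite !psi_a.
- by rewrite !psi_a.
- rewrite psi_b1 !rmorphM /= !psi_aXz psi_b1.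
  by rewrite -!mulrA (mulrA (a3 ^ s)) aC -!mulrA !aK.
- by rewrite psi_b2 rmorphM /= psi_aXz psi_b2 aK.
- by rewrite psi_b3 rmorphM /= psi_aXz psi_b3 aK.
Qed.

Lemma psi_bij s : bijective (psi s).
Proof.
by exists (psi (- s)); [exact: psiNK | have := psiNK (- s); rewrite opprK].
Qed.

Lemma calF_a1 : calF a1 = a1. Proof. exact: qsubst_qa. Qed.
Lemma calF_a2 : calF a2 = a1 * a3. Proof. exact: qsubst_qa. Qed.
Lemma calF_a3 : calF a3 = a1^-1 * a2. Proof. exact: qsubst_qa. Qed.
Lemma calF_b1 : calF b1 = b1 * b2 * b3^-1. Proof. exact: qsubst_qb. Qed.
Lemma calF_b2 : calF b2 = b3. Proof. exact: qsubst_qb. Qed.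
Lemma calF_b3 : calF b3 = b2. Proof. exact: qsubst_qb. Qed.

Lemma calFK : involutive calF.
Proof.
apply: (@qtorus_lrmorphism_id (calF \o calF)); apply: ord3P => /=.
- by rewrite !calF_a1.
- by rewrite calF_a2 rmorphM /= calF_a1 calF_a3 mulVKr ?qa_unit.
- rewrite calF_a3 rmorphM rmorphV ?qa_unit //= calF_a1 calF_a2.
  by rewrite mulKr ?qa_unit.
- rewrite calF_b1 !rmorphM rmorphV ?qb_unit //= calF_b1 calF_b2 calF_b3.
  by rewrite divrK ?qb_unit // mulrK ?qb_unit.
- by rewrite calF_b2 calF_b3.
- by rewrite calF_b3 calF_b2.
Qed.

End Automorphisms.

Arguments psi {F q} q0 s x.
Arguments calF {F q} q0 x.

Section Elements.
Variables (F : fieldType) (q : F) (q0 : q != 0).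
Local Notation Q := (qtorus q0).
Local Notation a1 := (qa q0 0).
Local Notation a2 := (qa q0 1).
Local Notation a3 := (qa q0 2).
Local Notation b1 := (qb q0 0).
Local Notation b2 := (qb q0 1).
Local Notation b3 := (qb q0 2).

Definition mx3 (rows : seq (seq Q)) : 'M[Q]_3 :=
  \matrix_(i, j) (nth [::] rows i)`_j.

Definition Tmx (r : int) (lambda eta : F) : 'M[Q]_3 :=
  eta%:A *: (mx3 [:: [:: a1; b1;         0];
                     [:: 0;  a1 ^ (- r); 0];
                     [:: 0;  0;          1]]
          *m mx3 [:: [:: 1; 0;  0         ];
                     [:: 0; a2; b2        ];
                     [:: 0; 0;  a2 ^ (- r)]]
          *m mx3 [:: [:: 1; 0;         0];
                     [:: 0; lambda%:A; 0];
                     [:: 0; 0;         1]]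
          *m mx3 [:: [:: a3; b3;         0];
                     [:: 0;  a3 ^ (- r); 0];
                     [:: 0;  0;          1]]).

Definition Ttmx (r : int) (lambda eta : F) : 'M[Q]_3 :=
  eta%:A *: (mx3 [:: [:: 1; 0;  0         ];
                     [:: 0; a3; b3        ];
                     [:: 0; 0;  a3 ^ (- r)]]
          *m mx3 [:: [:: 1; 0;         0];
                     [:: 0; lambda%:A; 0];
                     [:: 0; 0;         1]]
          *m mx3 [:: [:: a2; b2;         0];
                     [:: 0;  a2 ^ (- r); 0];
                     [:: 0;  0;          1]]
          *m mx3 [:: [:: 1; 0;  0         ];
                     [:: 0; a1; b1        ];
                     [:: 0; 0;  a1 ^ (- r)]]).

Definition w (r s : int) : Q :=
  a1 ^ (r - s) * a2 ^ (s - r) * b1 * b3^-1 * a3 ^ (s + 1).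

Definition wtilde (r s : int) : Q :=
  a3 ^ (s - r) * b1 * b3^-1 * a1 ^ (- s - 1) * a2 ^ (s + 1).

End Elements.

Section PowerSeries.
Variable F : fieldType.

(* A formal power series is given by its sequence of coefficients. *)
Definition ps_mul (f g : nat -> F) : nat -> F :=
  fun n => \sum_(i < n.+1) f i * g (n - i)%N.

Definition ps_invertible (f : nat -> F) : Prop :=
  exists g : nat -> F, forall n, ps_mul f g n = (n == 0)%:R.

Definition qexp (p : F) : nat -> F :=
  fun n => (- 1) ^+ n / \prod_(1 <= k < n.+1) (1 - p ^+ k).

End PowerSeries.

Section Formal.
Variables (F : fieldType) (q : F) (q0 : q != 0).
Local Notation Q := (qtorus q0).

(* A formal, possibly infinite, combination: X (u, false) is the coefficient
   of the monomial u, X (u, true) that of the monomial u followed by symF. *)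
Definition formal := idx * bool -> F.

Definition formal_of (x : Q) : formal := fun k => if k.2 then 0 else x@_k.1.

Definition symF : formal := fun k => (k == (0, true))%:R.

(* (M symF^e) (N symF^d) = M calF^e(N) symF^(e + d), since symF x = calF x symF
   and symF^2 = 1; a boolean exponent e is read as 0 or 1. *)
Definition basis_mul (g h : idx * bool) : formal := fun k =>
  if k.2 == g.2 (+) h.2
  then (qmon q0 g.1 * iter g.2 (calF q0) (qmon q0 h.1) : Q)@_k.1 else 0.

Definition contribution (X Y : formal) (k : idx * bool)
    (gh : (idx * bool) * (idx * bool)) : F :=
  X gh.1 * Y gh.2 * basis_mul gh.1 gh.2 k.

Definition fmul_defined (X Y : formal) : Prop :=
  forall k, finite_set [set gh | contribution X Y k gh != 0].

(* Only meaningful under fmul_defined: \sum_(_ \in _) is 0 on infinite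
   supports. *)
Definition fmul (X Y : formal) : formal := fun k =>
  \sum_(gh \in [set: (idx * bool) * (idx * bool)]) contribution X Y k gh.

Definition ps_eval_defined (f : nat -> F) (x : Q) : Prop :=
  forall k, finite_set [set n | f n * formal_of (x ^+ n) k != 0].

Definition ps_eval (f : nat -> F) (x : Q) : formal := fun k =>
  \sum_(n \in [set: nat]) f n * formal_of (x ^+ n) k.

End Formal.

(* Main.v *)
Require Import Defs.
From HB Require Import structures.
From mathcomp Require Import all_boot all_order all_algebra.
From mathcomp Require Import finmap complex monalg.
From mathcomp Require Import boolp classical_sets functions cardinality fsbigop.
From mathcomp Require Import reals ring.

Set Implicit Arguments.
Unset Strict Implicit.
Unset Printing Implicit Defensive.

Import Order.TTheory GRing.Theory Num.Theory.
Local Open Scope classical_set_scope.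
Local Open Scope ring_scope.

(* Both w and wtilde are scalar multiples of monomials, and calF exchanges them;
   since r <> -1 the monomials wtilde^m w^n are pairwise distinct, so both
   expressions of the R-matrix are one array of coefficients indexed by (m, n).
   Products with a monomial shift the exponents and rescale the array. The
   entries (0,0), (0,2), (1,1) and (2,2) of T are exchanged by calF with those
   of Ttilde, which commute with w and wtilde. In the entries (0,1) and (1,2) a
   binomial meets a monomial, and comparing coefficients gives the recurrence
   c_(n+1) (1 - p^(n+1)) = - c_n of the quantum exponential. *)

(** * Formal combinations indexed by a family of basis elements *)

Section Combination.
Variable F : fieldType.

(** Meant for injective [g]: each fibre then has at most one point, so the value is [c i] at [g i]
    and 0 off the image of [g]. *)
Definition comb (I : choiceType) (g : I -> idx * bool) (c : I -> F) : formal F :=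
  fun k => \sum_(i \in [set i | g i = k]) c i.

Section OneIndex.
Variables (I : choiceType) (g : I -> idx * bool) (c : I -> F).

Lemma comb_in i : injective g -> comb g c (g i) = c i.
Proof.
move=> gI; transitivity (\sum_(j \in [set i]) c j); last exact: fsbig_set1.
apply: eq_fsbigl.
by apply/seteqP; split => j /= => [/gI|->].
Qed.

Lemma comb_out k : (forall i, g i <> k) -> comb g c k = 0.
Proof. by move=> gk; apply: fsbig1 => i /= /gk. Qed.

End OneIndex.

Lemma combP (I : choiceType) (g : I -> idx * bool) c (X : formal F) :
  injective g -> (forall i, X (g i) = c i) ->
  (forall k, (forall i, g i <> k) -> X k = 0) -> X = comb g c.
Proof.
move=> gI Xg X0; apply/funext => k.
have [[i <-]|nk] := pselect (exists i, g i = k); first by rewrite comb_in.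
have kg i : g i <> k by move=> gik; apply: nk; exists i.
by rewrite comb_out ?X0.
Qed.

(** Indices outside the image of [sigma] carry coefficient 0 and change nothing. This serves to drop
    a [unit] factor from an index, to let an exponent in [nat] run over [int], and to reindex along
    a bijection. *)
Lemma comb_extend (I J : choiceType) (sigma : I -> J) g' (g : I -> idx * bool)
    (c : I -> F) (c' : J -> F) :
  injective sigma -> injective g' -> (forall i, g i = g' (sigma i)) ->
  (forall i, c i = c' (sigma i)) -> (forall j, (forall i, sigma i <> j) -> c' j = 0) ->
  comb g c = comb g' c'.
Proof.
move=> sI gI ge ce c0.
have gsI : injective g by move=> i j; rewrite !ge => /gI /sI.
apply: combP => // [j|k kg'].
  have [[i <-]|nj] := pselect (exists i, sigma i = j).
    by rewrite -ge comb_in.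
  have sj i : sigma i <> j by move=> e; apply: nj; exists i.
  by rewrite comb_out ?c0 // => i; rewrite ge => /gI /sj.
by rewrite comb_out // => i; rewrite ge; exact: kg'.
Qed.

Lemma combD (I : choiceType) (g : I -> idx * bool) (c d : I -> F) :
  injective g ->
  (fun k => comb g c k + comb g d k) = comb g (fun i => c i + d i).
Proof.
by move=> gI; apply: combP => // [i|k gk]; rewrite ?comb_in ?comb_out ?addr0.
Qed.

End Combination.

(** * Products of formal combinations and their bilinearity *)

Section FormalProduct.
Variables (F : fieldType) (q : F) (q0 : q != 0).
Local Notation Q := (qtorus q0).
Local Notation formal := (formal F).

Definition idx_calF (u : idx) : idx :=
  (vec (u.1 0 + u.1 1 - u.1 2) (u.1 2) (u.1 1),
   vec (u.2 0) (u.2 0 + u.2 2) (u.2 1 - u.2 0)).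

Lemma vec_eta (i : {ffun 'I_3 -> int}) : i = vec (i 0) (i 1) (i 2).
Proof. by apply/ffunP; apply: ord3P; rewrite ffunE. Qed.

Lemma vecD a b c a' b' c' :
  vec a b c + vec a' b' c' = vec (a + a') (b + b') (c + c').
Proof. by apply/ffunP; apply: ord3P; rewrite !ffunE. Qed.

Lemma idx_calF_vec a b c x y z :
  idx_calF (vec a b c, vec x y z) = (vec (a + b - c) c b, vec x (x + z) (y - x)).
Proof. by rewrite /idx_calF /= !ffunE. Qed.

Lemma qmon_exprz (u : idx) (n : int) :
  dot u.2 u.1 = 0 -> qmon q0 u ^ n = qmon q0 (u *~ n).
Proof.
move=> u0.
have dotn m : dot u.2 (u *+ m).1 = 0.
  by elim: m => [|m IHm]; rewrite ?mulr0n ?dot0r // mulrS dotDr u0 IHm.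
have eN (m : nat) : qmon q0 u ^+ m = qmon q0 (u *+ m).
  elim: m => [|m IHm]; first by rewrite expr0 mulr0n qmon0.
  by rewrite exprS IHm qmonM dotn oppr0 expr0z scale1r mulrS.
case: n => m; first exact: eN.
have dotnn : dot (u *+ m.+1).2 (u *+ m.+1).1 = 0.
  elim: {2}m.+1 => [|k IHk]; first by rewrite mulr0n dot0r.
  elim: m.+1 {IHk} => [|l IHl]; first by rewrite mulr0n dot0l.
  by rewrite [in (u *+ l.+1).2]mulrS dotDl IHl dotn addr0.
rewrite NegzE -[LHS]/((qmon q0 u ^+ m.+1)^-1) eN.
apply: (mulrI (qmon_unit q0 (u *+ m.+1))).
(* The reordering cost against [u *~ - m.+1] is opposite to the cost against [u *+ m.+1], hence also
   0, and the two monomials are mutually inverse. *)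
have dotN : dot (u *+ m.+1).2 (u *~ - m.+1%:Z).1 = 0.
  have : dot (u *+ m.+1).2 (u *+ m.+1 + u *~ - m.+1%:Z).1 = 0.
    by rewrite mulrNz subrr dot0r.
  by rewrite dotDr dotnn add0r.
rewrite divrr ?qmon_unit // qmonM dotN oppr0 expr0z scale1r.
by rewrite mulrNz subrr qmon0.
Qed.

Lemma vecMz a b c n : vec a b c *~ n = vec (a * n) (b * n) (c * n).
Proof.
by apply/ffunP; apply: ord3P; rewrite ffunMzE !ffunE /= mulrzz.
Qed.

Lemma idx_vecMz a b c x y z n : (vec a b c, vec x y z) *~ n
  = (vec (a * n) (b * n) (c * n), vec (x * n) (y * n) (z * n)) :> idx.
Proof.
have pairMn (u : idx) m : u *+ m = (u.1 *+ m, u.2 *+ m).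
  elim: m => [|m IHm]; first by rewrite !mulr0n.
  by rewrite !mulrS IHm.
by rewrite -!vecMz; case: n => m; rewrite ?NegzE ?mulrNz -!pmulrn pairMn.
Qed.

Lemma idx_vecD a b c x y z a' b' c' x' y' z' :
  (vec a b c, vec x y z) + (vec a' b' c', vec x' y' z')
  = (vec (a + a') (b + b') (c + c'), vec (x + x') (y + y') (z + z')) :> idx.
Proof. by rewrite -!vecD. Qed.

Lemma qmonM0 u v :
  dot u.2 v.1 = 0 -> qmon q0 u * qmon q0 v = qmon q0 (u + v).
Proof. by move=> uv; rewrite qmonM uv oppr0 expr0z scale1r. Qed.

(** No power of [q] appears: [calF] sends each [a_i] to a monomial in the [a] alone and each [b_i]
    to one in the [b] alone, so the images only need reordering among commuting generators. *)
Lemma calF_qmon u : calF q0 (qmon q0 u) = qmon q0 (idx_calF u).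
Proof.
case: u => i j; rewrite /idx_calF [in LHS](vec_eta i) [in LHS](vec_eta j) /=.
move: (i 0) (i 1) (i 2) (j 0) (j 1) (j 2) => i1 i2 i3 j1 j2 j3.
rewrite qmon_vec !rmorphM /= !rmorphXz ?qa_unit ?qb_unit //=.
rewrite calF_a1 calF_a2 calF_a3 calF_b1 calF_b2 calF_b3.
pose e1 := (vec 1 0 0, vec 0 0 0); pose e2 := (vec 1 0 1, vec 0 0 0).
pose e3 := (vec (-1) 1 0, vec 0 0 0).
pose h1 := (vec 0 0 0, vec 1 1 (-1)); pose h2 := (vec 0 0 0, vec 0 0 1).
pose h3 := (vec 0 0 0, vec 0 1 0).
have gen (x : Q) u : qmon q0 u = x -> x = qmon q0 u by [].
rewrite (gen (qa q0 0 * qa q0 2) e2); last first.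
  by rewrite qmon_vec !(expr0z, expr1z, mul1r, mulr1).
rewrite (gen ((qa q0 0)^-1 * qa q0 1) e3); last first.
  by rewrite qmon_vec !(expr0z, expr1z, mul1r, mulr1) ?exprN1.
rewrite (gen (qb q0 0 * qb q0 1 * (qb q0 2)^-1) h1); last first.
  by rewrite qmon_vec !(expr0z, expr1z, mul1r, mulr1) ?exprN1.
have E1 : qa q0 0 = qmon q0 e1.
  by apply: gen; rewrite qmon_vec !(expr0z, expr1z, mul1r, mulr1).
have E2 : qb q0 2 = qmon q0 h2.
  by apply: gen; rewrite qmon_vec !(expr0z, expr1z, mul1r, mulr1).
have E3 : qb q0 1 = qmon q0 h3.
  by apply: gen; rewrite qmon_vec !(expr0z, expr1z, mul1r, mulr1).
rewrite E1 E2 E3 !qmon_exprz ?dot_vec //= !idx_vecMz.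
rewrite !(qmonM0, idx_vecD, dot_vec) /=; try ring.
congr (qmon _ (vec _ _ _, vec _ _ _)); ring.
Qed.

(** The product of two basis elements is again one basis element, [basis_target], times the scalar
    [basis_scalar]; carrying [symF] past the second monomial applies [idx_calF] to its exponents. *)
Definition basis_target (g h : idx * bool) : idx * bool :=
  (g.1 + iter g.2 idx_calF h.1, g.2 (+) h.2).

Definition basis_scalar (g h : idx * bool) : F :=
  q ^ (- dot g.1.2 (iter g.2 idx_calF h.1).1).

Lemma iter_calF_qmon n u :
  iter n (calF q0) (qmon q0 u) = qmon q0 (iter n idx_calF u).
Proof. by elim: n => //= n ->; rewrite calF_qmon. Qed.

Lemma mcoeff_qmon u v : (qmon q0 u : {malg F[idx]})@_v = (v == u)%:R.
Proof. by rewrite /qmon mon.unlock mcoeffU eq_sym. Qed.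

Lemma basis_mulE g h k :
  basis_mul q0 g h k = basis_scalar g h * (k == basis_target g h)%:R.
Proof.
rewrite /basis_mul iter_calF_qmon qmonM mcoeffZ mcoeff_qmon.
case: k => k e; rewrite /basis_target xpair_eqE /=.
by case: (e == _); rewrite ?andbT ?andbF ?mulr0.
Qed.

(** Injectivity of the targets means that each basis element receives at most one contribution,
    which gives both the definedness and the value of the product. *)
Lemma fmul_comb (I J : choiceType) (g : I -> idx * bool) (h : J -> idx * bool)
    (c : I -> F) (d : J -> F) :
  injective g -> injective h ->
  injective (fun ij : I * J => basis_target (g ij.1) (h ij.2)) ->
  fmul_defined q0 (comb g c) (comb h d) /\
  fmul q0 (comb g c) (comb h d)
  = comb (fun ij : I * J => basis_target (g ij.1) (h ij.2))
         (fun ij => c ij.1 * d ij.2 * basis_scalar (g ij.1) (h ij.2)).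
Proof.
move=> gI hI tI.
have supp k gh : contribution q0 (comb g c) (comb h d) k gh != 0 ->
    exists ij : I * J, gh = (g ij.1, h ij.2) /\ basis_target (g ij.1) (h ij.2) = k.
  case: gh => a b; rewrite /contribution /= basis_mulE !mulf_eq0 !negb_or.
  have [[i <-]|ni] := pselect (exists i, g i = a); last first.
    by rewrite comb_out ?eqxx // => i e; apply: ni; exists i.
  have [[j <-]|nj] := pselect (exists j, h j = b); last first.
    by rewrite (@comb_out _ _ h) ?eqxx ?andbF // => j e; apply: nj; exists j.
  case: (k =P _) => [-> _|_]; last by rewrite eqxx !andbF.
  by exists (i, j).
have suppi (ij : I * J) gh :
    contribution q0 (comb g c) (comb h d)
      (basis_target (g ij.1) (h ij.2)) gh != 0 -> gh = (g ij.1, h ij.2).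
  by move=> /supp[ij' [-> /tI ->]].
split=> [k|].
  have [[ij <-]|nk] := pselect
      (exists ij : I * J, basis_target (g ij.1) (h ij.2) = k).
    by apply: (sub_finite_set (B := [set (g ij.1, h ij.2)])) => // gh /= /suppi.
  apply: (sub_finite_set (B := set0)) => // gh /= /supp[ij [_ e]].
  by apply: nk; exists ij.
apply: combP => // [ij|k kt]; rewrite /fmul.
  rewrite -(@fsbig_widen _ _ _ _ [set (g ij.1, h ij.2)]) ?fsbig_set1 //.
    by rewrite /contribution /= !comb_in // basis_mulE eqxx mulr1.
  by move=> gh [_ /= ngh]; apply/eqP; apply: contraPT ngh => /suppi ->; apply.
apply: fsbig1 => gh _; apply/eqP; apply: contraT => /supp[ij [_ e]].
by case: (kt ij).
Qed.

Lemma fsum_split (T : choiceType) (a b : T -> F) :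
  finite_set [set x | a x != 0] -> finite_set [set x | b x != 0] ->
  finite_set [set x | a x + b x != 0] /\
  \sum_(x \in [set: T]) (a x + b x)
  = \sum_(x \in [set: T]) a x + \sum_(x \in [set: T]) b x.
Proof.
(* All three sums are taken over the common finite set [D], where additivity is available. *)
move=> fa fb; set D := [set x | a x != 0] `|` [set x | b x != 0].
have fD : finite_set D by rewrite finite_setU; split.
have sub0 (c : T -> F) : [set x | c x != 0] `<=` D ->
    \sum_(x \in [set: T]) c x = \sum_(x \in D) c x.
  move=> cD; rewrite -(@fsbig_widen _ _ _ _ D) // => x [_ /= nD].
  by apply/eqP; apply: contraPT nD => n0; apply; apply: cD.
have subD : [set x | a x + b x != 0] `<=` D.
  move=> x /= n0; apply/orP; apply: contraNT n0.
  by rewrite negb_or !negbK => /andP[/eqP-> /eqP->]; rewrite addr0.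
split; first exact: sub_finite_set subD fD.
by rewrite !sub0 ?fsbig_split //; [exact: subsetUr | exact: subsetUl].
Qed.

Lemma fmulDr X Y Z : fmul_defined q0 X Y -> fmul_defined q0 X Z ->
  fmul_defined q0 X (fun k => Y k + Z k) /\
  fmul q0 X (fun k => Y k + Z k) = (fun k => fmul q0 X Y k + fmul q0 X Z k).
Proof.
move=> dY dZ.
have cE k : contribution q0 X (fun k => Y k + Z k) k
    = (fun gh => contribution q0 X Y k gh + contribution q0 X Z k gh).
  by apply/funext => gh; rewrite /contribution mulrDr mulrDl.
split=> [k|]; last apply/funext => k.
  by rewrite cE; case: (fsum_split (dY k) (dZ k)).
by rewrite /fmul cE; case: (fsum_split (dY k) (dZ k)).
Qed.

Lemma fmulDl X Y Z : fmul_defined q0 X Z -> fmul_defined q0 Y Z ->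
  fmul_defined q0 (fun k => X k + Y k) Z /\
  fmul q0 (fun k => X k + Y k) Z = (fun k => fmul q0 X Z k + fmul q0 Y Z k).
Proof.
move=> dX dY.
have cE k : contribution q0 (fun k => X k + Y k) Z k
    = (fun gh => contribution q0 X Z k gh + contribution q0 Y Z k gh).
  by apply/funext => gh; rewrite /contribution !mulrDl.
split=> [k|]; last apply/funext => k.
  by rewrite cE; case: (fsum_split (dX k) (dY k)).
by rewrite /fmul cE; case: (fsum_split (dX k) (dY k)).
Qed.

End FormalProduct.

(** * Ring elements, [symF] and power series as combinations; multiplication by a monomial *)

Section Families.
Variables (F : fieldType) (q : F) (q0 : q != 0).
Local Notation Q := (qtorus q0).

Lemma formal_of_qmon c v : formal_of (c *: qmon q0 v)
  = comb (fun _ : unit => (v, false)) (fun=> c).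
Proof.
apply: combP => [[] []//|_|[k e] nk]; rewrite /formal_of mcoeffZ mcoeff_qmon /=.
  by rewrite eqxx mulr1.
case: e nk => // nk; case: eqP => [kv|_]; last by rewrite /= mulr0.
by case: (nk tt); rewrite kv.
Qed.

Lemma formal_ofD (x y : Q) :
  formal_of (x + y) = (fun k => formal_of x k + formal_of y k).
Proof.
by apply/funext => -[k []]; rewrite /formal_of /= ?addr0 // mcoeffD.
Qed.

Lemma symF_comb : symF F = comb (fun _ : unit => (0, true)) (fun=> 1).
Proof.
apply: combP => [[] []//|_|k nk]; rewrite /symF ?eqxx //.
by case: eqP => // k0; case: (nk tt).
Qed.

(** Distinct powers of [x] sit on distinct monomials, so no coefficient collects more than one term
    of the series. *)
Lemma ps_eval_comb (f c : nat -> F) (x : Q) (v : nat -> idx) :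
  injective v -> (forall n, x ^+ n = c n *: qmon q0 (v n)) ->
  ps_eval_defined f x /\
  ps_eval f x = comb (fun n => (v n, false)) (fun n => f n * c n).
Proof.
move=> vI xE.
have xk n k : formal_of (x ^+ n) k = c n * (k == (v n, false))%:R.
  rewrite xE /formal_of mcoeffZ mcoeff_qmon; case: k => k [] //=.
    by rewrite xpair_eqE andbF /= mulr0.
  by rewrite xpair_eqE andbT.
have supp n k : f n * formal_of (x ^+ n) k != 0 -> k = (v n, false).
  by rewrite xk; case: (k =P _) => //= _; rewrite !mulr0 eqxx.
split=> [k|].
  have [[n ->]|nk] := pselect (exists n, k = (v n, false)).
    by apply: (sub_finite_set (B := [set n])) => // m /= /supp/(congr1 fst)/vI.
  apply: (sub_finite_set (B := set0)) => // m /= /supp km.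
  by apply: nk; exists m.
apply: combP => [m n /(congr1 fst)/vI//|n|k nk]; rewrite /ps_eval.
  rewrite -(@fsbig_widen _ _ _ _ [set n]) ?fsbig_set1 //.
    by rewrite xk eqxx mulr1.
  move=> m [_ /= nm]; apply/eqP; apply: contraPT nm => /supp/(congr1 fst)/vI ->; exact.
apply: fsbig1 => n _; apply/eqP; apply: contraT => /supp kn.
by case: (nk n).
Qed.

(** Multiplying [u] by its [k]-th power costs [k] times [dot u.2 u.1] in the exponent of [q];
    summing over [k < n] gives the binomial coefficient. *)
Lemma qmon_scaleXn (c : F) (u : idx) n : (c *: qmon q0 u) ^+ n
  = (c ^+ n * q ^ (- (dot u.2 u.1 * 'C(n, 2)%:Z))) *: qmon q0 (u *+ n).
Proof.
have dotMn k : dot u.2 (u *+ k).1 = dot u.2 u.1 * k%:Z.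
  elim: k => [|k IHk]; first by rewrite mulr0n dot0r mulr0.
  by rewrite mulrS dotDr IHk intS mulrDr mulr1.
elim: n => [|n IHn].
  by rewrite !expr0 mulr0 oppr0 expr0z mulr1 scale1r mulr0n qmon0.
rewrite exprS IHn -scalerAl -scalerAr qmonM !scalerA mulrS dotMn exprS.
rewrite binS bin1 PoszD mulrDr opprD (expfzDr _ _ q0) !mulrA.
by congr (_ *: _); rewrite mulrAC.
Qed.

Section RightModule.
Variables (I : choiceType) (P : I -> idx) (C : I -> F).
Hypothesis PI : injective P.
Local Notation X := (comb (fun i => (P i, true)) C).

(** On its way to the left the monomial crosses [symF] and becomes [idx_calF v]; translating all
    exponents by it keeps the family injective. *)
Lemma fmul_comb_qmon c v :
  fmul_defined q0 X (formal_of (c *: qmon q0 v)) /\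
  fmul q0 X (formal_of (c *: qmon q0 v))
  = comb (fun i => (P i + idx_calF v, true))
         (fun i => C i * c * q ^ (- dot (P i).2 (idx_calF v).1)).
Proof.
rewrite formal_of_qmon.
have [] := @fmul_comb _ _ q0 I unit (fun i => (P i, true))
  (fun=> (v, false)) C (fun=> c).
- by move=> i j /(congr1 fst)/PI.
- by move=> [] [].
- by move=> [i []] [j []] /(congr1 fst)/addIr/PI /= ->.
move=> ? ->; split=> //.
apply: (@comb_extend _ _ _ fst) => //.
- by move=> [i []] [j []] /= ->.
- by move=> i j /(congr1 fst)/addIr/PI.
- by move=> i ni; case: (ni (i, tt)).
Qed.

Lemma fmul_qmon_comb c v :
  fmul_defined q0 (formal_of (c *: qmon q0 v)) X /\
  fmul q0 (formal_of (c *: qmon q0 v)) X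
  = comb (fun i => (P i + v, true)) (fun i => C i * c * q ^ (- dot v.2 (P i).1)).
Proof.
rewrite formal_of_qmon.
have [] := @fmul_comb _ _ q0 unit I (fun=> (v, false))
  (fun i => (P i, true)) (fun=> c) C.
- by move=> [] [].
- by move=> i j /(congr1 fst)/PI.
- by move=> [[] i] [[] j] /(congr1 fst)/addrI/PI /= ->.
move=> ? ->; split=> //.
apply: (@comb_extend _ _ _ snd) => //=.
- by move=> [[] i] [[] j] /= ->.
- by move=> i j /(congr1 fst)/addIr/PI.
- by move=> [[] i] /=; rewrite /basis_target /= addrC.
- by move=> [[] i] /=; rewrite /basis_scalar /= (mulrC c).
- by move=> i ni; case: (ni (tt, i)).
Qed.

End RightModule.

End Families.

(** * The elements [w] and [wtilde], their powers and their exponents *)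

Section Weights.
Variables (F : fieldType) (q : F) (q0 : q != 0).
Local Notation Q := (qtorus q0).

Lemma qmon_vecM a b c x y z a' b' c' x' y' z' :
  qmon q0 (vec a b c, vec x y z) * qmon q0 (vec a' b' c', vec x' y' z')
  = q ^ (- (x * a' + y * b' + z * c')) *:
      qmon q0 (vec (a + a') (b + b') (c + c'), vec (x + x') (y + y') (z + z')).
Proof. by rewrite qmonM dot_vec idx_vecD. Qed.

Lemma eq_qmon e e' u u' : e = e' -> u = u' ->
  q ^ e *: qmon q0 u = q ^ e' *: qmon q0 u'.
Proof. by move=> -> ->. Qed.

Lemma eq_vecs a b c x y z a' b' c' x' y' z' :
  a = a' -> b = b' -> c = c' -> x = x' -> y = y' -> z = z' ->
  (vec a b c, vec x y z) = (vec a' b' c', vec x' y' z').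
Proof. by move=> -> -> -> -> -> ->. Qed.

Lemma qa1Xz n : qa q0 0 ^ n = qmon q0 (vec n 0 0, vec 0 0 0).
Proof. by rewrite qmon_vec !(expr0z, mul1r, mulr1). Qed.

Lemma qa2Xz n : qa q0 1 ^ n = qmon q0 (vec 0 n 0, vec 0 0 0).
Proof. by rewrite qmon_vec !(expr0z, mul1r, mulr1). Qed.

Lemma qa3Xz n : qa q0 2 ^ n = qmon q0 (vec 0 0 n, vec 0 0 0).
Proof. by rewrite qmon_vec !(expr0z, mul1r, mulr1). Qed.

Lemma qb1E : qb q0 0 = qmon q0 (vec 0 0 0, vec 1 0 0).
Proof. by rewrite qmon_vec !(expr0z, expr1z, mul1r, mulr1). Qed.

Lemma qb2E : qb q0 1 = qmon q0 (vec 0 0 0, vec 0 1 0).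
Proof. by rewrite qmon_vec !(expr0z, expr1z, mul1r, mulr1). Qed.

Lemma qb3E : qb q0 2 = qmon q0 (vec 0 0 0, vec 0 0 1).
Proof. by rewrite qmon_vec !(expr0z, expr1z, mul1r, mulr1). Qed.

Lemma qb3VE : (qb q0 2)^-1 = qmon q0 (vec 0 0 0, vec 0 0 (-1)).
Proof. by rewrite qmon_vec !(expr0z, expr1z, mul1r, mulr1) exprN1. Qed.

Variables r s : int.

Definition idx_w : idx := (vec (r - s) (s - r) (s + 1), vec 1 0 (-1)).
Definition idx_wt : idx := (vec (- s - 1) (s + 1) (s - r), vec 1 0 (-1)).

(** The scalar comes from moving the inverse of [b3] past [a3 ^ (s + 1)]. *)
Lemma wE : w q0 r s = q ^ (s + 1) *: qmon q0 idx_w.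
Proof.
rewrite /w qa1Xz qa2Xz qa3Xz qb1E qb3VE.
rewrite !(qmon_vecM, =^~ scalerAl, scalerA) -?(expfzDr _ _ q0).
by apply: eq_qmon; [|apply: eq_vecs]; ring.
Qed.

(** Here the scalar comes from moving [b1] past [a1 ^ (- s - 1)], and it agrees with that of [w]. *)
Lemma wtildeE : wtilde q0 r s = q ^ (s + 1) *: qmon q0 idx_wt.
Proof.
rewrite /wtilde qa1Xz qa2Xz qa3Xz qb1E qb3VE.
rewrite !(qmon_vecM, =^~ scalerAl, scalerA) -?(expfzDr _ _ q0).
by apply: eq_qmon; [|apply: eq_vecs]; ring.
Qed.

(* w ^+ n is wscalar n times the monomial of exponents n idx_w; since w commutes
   with wtilde and calF exchanges them, the same scalars serve wtilde. *)
Definition wscalar (n : nat) : F :=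
  q ^ ((s + 1) * n%:Z - (r - s - s - 1) * 'C(n, 2)%:Z).

Lemma wX n : w q0 r s ^+ n = wscalar n *: qmon q0 (idx_w *~ n).
Proof.
rewrite wE qmon_scaleXn -[_ ^+ n]/((q ^ (s + 1)) ^ n%:Z) exprz_exp.
rewrite -(expfzDr _ _ q0) dot_vec -pmulrn /wscalar.
by apply: eq_qmon => //; ring.
Qed.

Lemma wtildeX n : wtilde q0 r s ^+ n = wscalar n *: qmon q0 (idx_wt *~ n).
Proof.
rewrite wtildeE qmon_scaleXn -[_ ^+ n]/((q ^ (s + 1)) ^ n%:Z) exprz_exp.
rewrite -(expfzDr _ _ q0) dot_vec -pmulrn /wscalar.
by apply: eq_qmon => //; ring.
Qed.

Lemma wscalarS n : wscalar n.+1 = wscalar n * q ^ (s + 1 - (r - s - s - 1) * n%:Z).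
Proof.
rewrite /wscalar -(expfzDr _ _ q0) binS bin1 PoszD intS.
by congr (q ^ _); ring.
Qed.

(** The correction is the cross term [m * n] in the binomial coefficient of [m + n]. It equals the
    cost of reordering [wtilde ^+ m * w ^+ n], so that product carries the single scalar
    [wscalar (m + n)]. *)
Lemma wscalarD m n :
  wscalar (m + n) = wscalar m * wscalar n * q ^ (- ((r - s - s - 1) * (m * n)%:Z)).
Proof.
elim: m => [|m IHm].
  rewrite add0n mul0n mulr0 oppr0 expr0z mulr1.
  by rewrite [wscalar 0]/wscalar !mulr0 subr0 expr0z mul1r.
rewrite addSn !wscalarS IHm /wscalar -!(expfzDr _ _ q0) mulSn !PoszD.
by congr (q ^ _); ring.
Qed.

Definition idx_R (mn : nat * int) : idx := idx_wt *~ mn.1 + idx_w *~ mn.2.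

Lemma idx_RE m n : idx_R (m, n) =
  (vec (- (m%:Z * (s + 1)) + n * (r - s)) (m%:Z * (s + 1) + n * (s - r))
       (m%:Z * (s - r) + n * (s + 1)), vec (m%:Z + n) 0 (- (m%:Z + n))).
Proof.
rewrite /idx_R /= !idx_vecMz idx_vecD.
by apply: eq_vecs; ring.
Qed.

Lemma vec_inj a b c a' b' c' :
  vec a b c = vec a' b' c' -> [/\ a = a', b = b' & c = c'].
Proof.
by move=> /ffunP e; move: (e 0) (e 1) (e 2); rewrite !ffunE.
Qed.

Hypothesis r1 : r != -1.

(** The exponent of [b1] fixes [m + n]. With that, the exponent of [a3] gives
    [(n - n') * (r + 1) = 0], and [r != -1] concludes. *)
Lemma idx_R_inj : injective idx_R.
Proof.
move=> [m n] [m' n']; rewrite !idx_RE => e.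
have [_ _ e3] := vec_inj (congr1 fst e); have [eN _ _] := vec_inj (congr1 snd e).
have : (n - n') * (r + 1) = 0.
  have -> : n = m'%:Z + n' - m%:Z by rewrite -eN; ring.
  have : (m%:Z - m'%:Z) * (s - r) + (n - n') * (s + 1) = 0.
    rewrite -(subrr (m%:Z * (s - r) + n * (s + 1))) {2}e3; ring.
  have -> : n = m'%:Z + n' - m%:Z by rewrite -eN; ring.
  by move=> <-; ring.
move/eqP; rewrite mulf_eq0 subr_eq0 addr_eq0 (negPf r1) orbF => /eqP en.
by move: eN; rewrite en => /addIr [->].
Qed.

Lemma idx_wt_inj : injective (fun m : nat => idx_wt *~ m).
Proof.
move=> m m' e; have := @idx_R_inj (m, 0) (m', 0).
by rewrite /idx_R /= !mulr0z !addr0 => /(_ e)[].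
Qed.

Lemma idx_w_inj : injective (fun n : nat => idx_w *~ n).
Proof.
move=> m m' e; have := @idx_R_inj (0, m%:Z) (0, m'%:Z).
by rewrite /idx_R /= !mulr0z !add0r => /(_ e)[].
Qed.

Lemma idx_calF_w (n : nat) : idx_calF (idx_w *~ n) = idx_wt *~ n.
Proof.
rewrite !idx_vecMz idx_calF_vec.
by apply: eq_vecs; ring.
Qed.

Lemma idx_calF_wt (n : nat) : idx_calF (idx_wt *~ n) = idx_w *~ n.
Proof.
rewrite !idx_vecMz idx_calF_vec.
by apply: eq_vecs; ring.
Qed.

End Weights.

(** * The entries of the twisted matrices as combinations of monomials *)

Section Entries.
Variables (F : fieldType) (q : F) (q0 : q != 0).
Local Notation Q := (qtorus q0).
Local Notation a1 := (qa q0 0).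
Local Notation a2 := (qa q0 1).
Local Notation a3 := (qa q0 2).
Local Notation b1 := (qb q0 0).
Local Notation b2 := (qb q0 1).
Local Notation b3 := (qb q0 2).

Lemma mulmx_mx3 (x00 x01 x02 x10 x11 x12 x20 x21 x22
                 y00 y01 y02 y10 y11 y12 y20 y21 y22 : Q) :
  mx3 [:: [:: x00; x01; x02]; [:: x10; x11; x12]; [:: x20; x21; x22]]
  *m mx3 [:: [:: y00; y01; y02]; [:: y10; y11; y12]; [:: y20; y21; y22]]
  = mx3 [:: [:: x00 * y00 + x01 * y10 + x02 * y20;
                x00 * y01 + x01 * y11 + x02 * y21;
                x00 * y02 + x01 * y12 + x02 * y22];
            [:: x10 * y00 + x11 * y10 + x12 * y20;
                x10 * y01 + x11 * y11 + x12 * y21;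
                x10 * y02 + x11 * y12 + x12 * y22];
            [:: x20 * y00 + x21 * y10 + x22 * y20;
                x20 * y01 + x21 * y11 + x22 * y21;
                x20 * y02 + x21 * y12 + x22 * y22]].
Proof.
apply/matrixP => i j; rewrite !mxE !big_ord_recl big_ord0 addr0 !mxE addrA /=.
by move: i j; do 2!apply: ord3P.
Qed.

Lemma TmxE r lambda eta : Tmx q0 r lambda eta = eta%:A *: mx3
  [:: [:: a1 * a3; a1 * b3 + lambda *: (b1 * a2 * a3 ^ (- r)); b1 * b2];
      [:: 0; lambda *: (a1 ^ (- r) * a2 * a3 ^ (- r)); a1 ^ (- r) * b2];
      [:: 0; 0; a2 ^ (- r)]].
Proof.
rewrite /Tmx !mulmx_mx3.
rewrite !(mul0r, mulr0, mul1r, mulr1, add0r, addr0, mulr_algr, scaler0, =^~ scalerAl).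
by [].
Qed.

Lemma TtmxE r lambda eta : Ttmx q0 r lambda eta = eta%:A *: mx3
  [:: [:: a2; b2 * a1; b2 * b1];
      [:: 0; lambda *: (a3 * a2 ^ (- r) * a1);
          lambda *: (a3 * a2 ^ (- r) * b1) + b3 * a1 ^ (- r)];
      [:: 0; 0; a3 ^ (- r) * a1 ^ (- r)]].
Proof.
rewrite /Ttmx !mulmx_mx3.
rewrite !(mul0r, mulr0, mul1r, mulr1, add0r, addr0, mulr_algr, =^~ scalerAl).
by [].
Qed.

Local Notation V a b c x y z := (qmon q0 (vec a b c, vec x y z)).

Lemma qa1E : a1 = V 1 0 0 0 0 0. Proof. by rewrite -qa1Xz expr1z. Qed.
Lemma qa2E : a2 = V 0 1 0 0 0 0. Proof. by rewrite -qa2Xz expr1z. Qed.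
Lemma qa3E : a3 = V 0 0 1 0 0 0. Proof. by rewrite -qa3Xz expr1z. Qed.

Local Ltac to_qmon := rewrite ?(qa1Xz, qa2Xz, qa3Xz);
  rewrite ?(qa1E, qa2E, qa3E, qb1E, qb2E, qb3E);
  rewrite !(qmon_vecM, =^~ scalerAl, =^~ scalerAr, scalerA)
  -?(expfzDr _ _ q0); apply: eq_qmon; [|apply: eq_vecs]; ring.

Lemma psiZ s (c : F) x : psi q0 s (c *: x) = c *: psi q0 s x.
Proof. exact: linearZ. Qed.

Lemma psiD s x y : psi q0 s (x + y) = psi q0 s x + psi q0 s y.
Proof. exact: linearD. Qed.

(** Only the entry (0,1) is a binomial. The factor [q ^ (- s)] in the entry (0,2) comes from moving
    [b1] past [a1 ^ s]. *)
Lemma psi_TmxE r s lambda eta : map_mx (psi q0 s) (Tmx q0 r lambda eta) = mx3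
  [:: [:: eta *: V 1 0 1 0 0 0;
          eta *: V (s + 1) 0 0 0 0 1 + (eta * lambda) *: V 0 (s + 1) (s - r) 1 0 0;
          (eta * q ^ (- s)) *: V s s s 1 1 0];
      [:: 0; (eta * lambda) *: V (- r) 1 (- r) 0 0 0; eta *: V (s - r) 0 0 0 1 0];
      [:: 0; 0; eta *: V 0 (- r) 0 0 0 0]].
Proof.
(* The trivial factor [q ^ 0] gives every identity the shape, a power of [q] times a monomial, to
   which [to_qmon] applies. *)
have e00 : a1 * a3 = q ^ 0 *: V 1 0 1 0 0 0 by to_qmon.
have e01 : a1 * (a1 ^ s * b3) = q ^ 0 *: V (s + 1) 0 0 0 0 1 by to_qmon.
have e01' : a2 ^ s * a3 ^ s * b1 * a2 * a3 ^ (- r)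
   = q ^ 0 *: V 0 (s + 1) (s - r) 1 0 0 by to_qmon.
have e02 : a2 ^ s * a3 ^ s * b1 * (a1 ^ s * b2) = q ^ (- s) *: V s s s 1 1 0.
  by to_qmon.
have e11 : a1 ^ (- r) * a2 * a3 ^ (- r) = q ^ 0 *: V (- r) 1 (- r) 0 0 0.
  by to_qmon.
have e12 : a1 ^ (- r) * (a1 ^ s * b2) = q ^ 0 *: V (s - r) 0 0 0 1 0 by to_qmon.
have pM x y x' y' :
    psi q0 s x = x' -> psi q0 s y = y' -> psi q0 s (x * y) = x' * y'.
  by rewrite rmorphM /= => -> ->.
have pa := psi_a q0 s; have paX := psi_aXz q0 s.
have pb1 := psi_b1 q0 s; have pb2 := psi_b2 q0 s; have pb3 := psi_b3 q0 s.
rewrite TmxE; apply/matrixP => i j; rewrite !mxE mulr_algl psiZ.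
move: i j; apply: ord3P; apply: ord3P => /=.
- rewrite (pM _ _ _ _ (pa 0) (pa 2)) e00 scale1r. reflexivity.
- rewrite psiD psiZ (pM _ _ _ _ (pa 0) pb3).
  rewrite (pM _ _ _ _ (pM _ _ _ _ pb1 (pa 1)) (paX 2 (- r))) e01 e01' !scale1r.
  rewrite scalerDr scalerA. reflexivity.
- rewrite (pM _ _ _ _ pb1 pb2) e02 scalerA. reflexivity.
- rewrite linear0 scaler0. reflexivity.
- rewrite psiZ (pM _ _ _ _ (pM _ _ _ _ (paX 0 (- r)) (pa 1)) (paX 2 (- r))).
  rewrite e11 scale1r scalerA. reflexivity.
- rewrite (pM _ _ _ _ (paX 0 (- r)) pb2) e12 scale1r. reflexivity.
- rewrite linear0 scaler0. reflexivity.
- rewrite linear0 scaler0. reflexivity.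
- rewrite paX qa2Xz. reflexivity.
Qed.

(** The binomial is now the entry (1,2). In the entry (0,2) it is [b2] passing [a2 ^ s] that yields
    [q ^ (- s)], so this entry is the same as in [psi_TmxE]. *)
Lemma psi_TtmxE r s lambda eta : map_mx (psi q0 s) (Ttmx q0 r lambda eta) = mx3
  [:: [:: eta *: V 0 1 0 0 0 0; eta *: V (s + 1) 0 0 0 1 0;
          (eta * q ^ (- s)) *: V s s s 1 1 0];
      [:: 0; (eta * lambda) *: V 1 (- r) 1 0 0 0;
          (eta * lambda) *: V 0 (s - r) (s + 1) 1 0 0 + eta *: V (s - r) 0 0 0 0 1];
      [:: 0; 0; eta *: V (- r) 0 (- r) 0 0 0]].
Proof.
have e01 : a1 ^ s * b2 * a1 = q ^ 0 *: V (s + 1) 0 0 0 1 0 by to_qmon.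
have e02 : a1 ^ s * b2 * (a2 ^ s * a3 ^ s * b1) = q ^ (- s) *: V s s s 1 1 0.
  by to_qmon.
have e11 : a3 * a2 ^ (- r) * a1 = q ^ 0 *: V 1 (- r) 1 0 0 0 by to_qmon.
have e12 : a3 * a2 ^ (- r) * (a2 ^ s * a3 ^ s * b1)
  = q ^ 0 *: V 0 (s - r) (s + 1) 1 0 0 by to_qmon.
have e12' : a1 ^ s * b3 * a1 ^ (- r) = q ^ 0 *: V (s - r) 0 0 0 0 1 by to_qmon.
have e22 : a3 ^ (- r) * a1 ^ (- r) = q ^ 0 *: V (- r) 0 (- r) 0 0 0 by to_qmon.
have pM x y x' y' :
    psi q0 s x = x' -> psi q0 s y = y' -> psi q0 s (x * y) = x' * y'.
  by rewrite rmorphM /= => -> ->.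
have pa := psi_a q0 s; have paX := psi_aXz q0 s.
have pb1 := psi_b1 q0 s; have pb2 := psi_b2 q0 s; have pb3 := psi_b3 q0 s.
rewrite TtmxE; apply/matrixP => i j; rewrite !mxE mulr_algl psiZ.
move: i j; apply: ord3P; apply: ord3P => /=.
- rewrite pa qa2E. reflexivity.
- rewrite (pM _ _ _ _ pb2 (pa 0)) e01 scale1r. reflexivity.
- rewrite (pM _ _ _ _ pb2 pb1) e02 scalerA. reflexivity.
- rewrite linear0 scaler0. reflexivity.
- rewrite psiZ (pM _ _ _ _ (pM _ _ _ _ (pa 2) (paX 1 (- r))) (pa 0)).
  rewrite e11 scale1r scalerA. reflexivity.
- rewrite psiD psiZ (pM _ _ _ _ (pM _ _ _ _ (pa 2) (paX 1 (- r))) pb1).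
  rewrite (pM _ _ _ _ pb3 (paX 0 (- r))) e12 e12' !scale1r.
  rewrite scalerDr scalerA. reflexivity.
- rewrite linear0 scaler0. reflexivity.
- rewrite linear0 scaler0. reflexivity.
- rewrite (pM _ _ _ _ (paX 2 (- r)) (paX 0 (- r))) e22 scale1r. reflexivity.
Qed.

End Entries.

(** * Both expressions of the R-matrix as one combination, for arbitrary series [f] and [g] *)

Section RMatrix.
Variables (F : fieldType) (q : F) (q0 : q != 0) (r s : int) (r1 : r != -1).
Variables (f g : nat -> F) (lambda : F).

Local Notation idx_R := (idx_R r s).
Local Notation idx_w := (idx_w r s).
Local Notation idx_wt := (idx_wt r s).
Local Notation wscalar := (wscalar q r s).

(* The exponent n of w runs over int, with zero coefficients for n < 0, to make
   n |-> n + 1 a bijection. *)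
Definition R_coef (mn : nat * int) : F :=
  if mn.2 is Posz n
  then f mn.1 * (g n * lambda ^+ n) * wscalar (mn.1 + n)%N else 0.

Definition R_comb : formal F := comb (fun mn => (idx_R mn, true)) R_coef.

Lemma lambda_wX n :
  (lambda *: w q0 r s) ^+ n
  = (lambda ^+ n * wscalar n) *: qmon q0 (idx_w *~ n).
Proof. by rewrite exprZn wX scalerA. Qed.

Lemma lambda_wtildeX n :
  (lambda *: wtilde q0 r s) ^+ n
  = (lambda ^+ n * wscalar n) *: qmon q0 (idx_wt *~ n).
Proof. by rewrite exprZn wtildeX scalerA. Qed.

Lemma dot_wt_w (m n : nat) :
  dot (idx_wt *~ m).2 (idx_w *~ n).1 = (r - s - s - 1) * (m * n)%:Z.
Proof. by rewrite !idx_vecMz dot_vec PoszM; ring. Qed.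

(** Both multiplications keep the family injectively indexed: the exponents of
    [wtilde ^+ m * w ^+ n] determine [(m, n)], and [symF] on the right only changes the flag. *)
Lemma R_product :
  fmul_defined q0 (ps_eval f (wtilde q0 r s)) (ps_eval g (lambda *: w q0 r s)) /\
  fmul_defined q0
    (fmul q0 (ps_eval f (wtilde q0 r s)) (ps_eval g (lambda *: w q0 r s)))
    (symF F) /\
  fmul q0
    (fmul q0 (ps_eval f (wtilde q0 r s)) (ps_eval g (lambda *: w q0 r s)))
    (symF F) = R_comb.
Proof.
have [_ ->] := ps_eval_comb f (idx_wt_inj r1) (wtildeX q0 r s).
have [_ ->] := ps_eval_comb g (idx_w_inj r1) lambda_wX.
rewrite symF_comb.
have inj2 (ij kl : nat * nat) :
    idx_wt *~ ij.1 + idx_w *~ ij.2 = idx_wt *~ kl.1 + idx_w *~ kl.2 -> ij = kl.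
  case: ij kl => [i j] [k l] /= e.
  by case: (@idx_R_inj _ _ r1 (i, j%:Z) (k, l%:Z) e) => -> ->.
have [||ij kl|d1 ->] := @fmul_comb _ _ q0 nat nat (fun m => (idx_wt *~ m, false))
  (fun n => (idx_w *~ n, false)) (fun m => f m * wscalar m)
  (fun n => g n * (lambda ^+ n * wscalar n)).
- by move=> m n /(congr1 fst)/(idx_wt_inj r1).
- by move=> m n /(congr1 fst)/(idx_w_inj r1).
- by move/(congr1 fst)/inj2.
split; first exact: d1.
have [||ij kl|d2 ->] := @fmul_comb _ _ q0 (nat * nat)%type unit
  (fun mn => basis_target (idx_wt *~ mn.1, false) (idx_w *~ mn.2, false))
  (fun=> (0, true))
  (fun mn => f mn.1 * wscalar mn.1 * (g mn.2 * (lambda ^+ mn.2 * wscalar mn.2))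
     * basis_scalar q (idx_wt *~ mn.1, false) (idx_w *~ mn.2, false))
  (fun=> 1).
- by move=> ij kl /(congr1 fst)/inj2.
- by move=> [] [].
- case: ij kl => ij [] [kl []] /(congr1 fst) /= /addIr e.
  by rewrite (inj2 _ _ e).
split; first exact: d2.
(* The indices missed by this map have a negative power of [w], where [R_coef] is 0. *)
apply: (@comb_extend _ _ _ (fun mnt => (mnt.1.1, mnt.1.2%:Z))).
- by move=> [[m n] []] [[m' n'] []] [-> ->].
- by move=> mn mn' /(congr1 fst)/(idx_R_inj r1).
- by move=> [[m n] []]; rewrite /basis_target /= addr0.
- move=> [[m n] []]; rewrite /R_coef /basis_scalar /= dot_wt_w dot0r oppr0 expr0z.
  by rewrite (wscalarD q0); ring.
- move=> [m [n|n]] nmn; last by [].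
  by case: (nmn ((m, n), tt)).
Qed.

(** Crossing [symF] turns powers of [w] into powers of [wtilde] and then powers of [wtilde] into
    powers of [w], so the monomials and scalars are those of [R_product]. *)
Lemma R_product_tilde :
  fmul_defined q0 (symF F) (ps_eval f (w q0 r s)) /\
  fmul_defined q0
    (fmul q0 (symF F) (ps_eval f (w q0 r s))) (ps_eval g (lambda *: wtilde q0 r s)) /\
  fmul q0
    (fmul q0 (symF F) (ps_eval f (w q0 r s))) (ps_eval g (lambda *: wtilde q0 r s))
  = R_comb.
Proof.
have [_ ->] := ps_eval_comb f (idx_w_inj r1) (wX q0 r s).
have [_ ->] := ps_eval_comb g (idx_wt_inj r1) lambda_wtildeX.
rewrite symF_comb.
have tE (m : nat) : basis_target (0, true) (idx_w *~ m, false) = (idx_wt *~ m, true).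
  by rewrite /basis_target /= add0r idx_calF_w.
have tE2 (m n : nat) : basis_target (idx_wt *~ m, true) (idx_wt *~ n, false)
    = (idx_R (m, n%:Z), true).
  by rewrite /basis_target /= idx_calF_wt.
have sE (m n : nat) : basis_scalar q (idx_wt *~ m, true) (idx_wt *~ n, false)
    = q ^ (- ((r - s - s - 1) * (m * n)%:Z)).
  rewrite /basis_scalar -[iter _ _ _]/(idx_calF (idx_wt *~ n)) idx_calF_wt.
  by rewrite dot_wt_w.
have [||ij kl|d1 ->] := @fmul_comb _ _ q0 unit nat (fun=> (0, true))
  (fun m => (idx_w *~ m, false)) (fun=> 1) (fun m => f m * wscalar m).
- by move=> [] [].
- by move=> m n /(congr1 fst)/(idx_w_inj r1).
- case: ij kl => [] [] m [[] n] /=.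
  by rewrite !tE => /(congr1 fst)/(idx_wt_inj r1) ->.
split; first exact: d1.
have [||ij kl|d2 ->] := @fmul_comb _ _ q0 (unit * nat)%type nat
  (fun tm => basis_target (0, true) (idx_w *~ tm.2, false))
  (fun n => (idx_wt *~ n, false))
  (fun tm => 1 * (f tm.2 * wscalar tm.2)
     * basis_scalar q (0, true) (idx_w *~ tm.2, false))
  (fun n => g n * (lambda ^+ n * wscalar n)).
- by move=> [[] m] [[] n] /=; rewrite !tE => /(congr1 fst)/(idx_wt_inj r1) ->.
- by move=> m n /(congr1 fst)/(idx_wt_inj r1).
- case: ij kl => [[[] m] n] [[[] m'] n'] /=.
  by rewrite !tE !tE2 => /(congr1 fst)/(idx_R_inj r1)[-> ->].
split; first exact: d2.
apply: (@comb_extend _ _ _ (fun tmn => (tmn.1.2, tmn.2%:Z))).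
- by move=> [[[] m] n] [[[] m'] n'] [-> ->].
- by move=> mn mn' /(congr1 fst)/(idx_R_inj r1).
- by move=> [[[] m] n] /=; rewrite tE tE2.
- move=> [[[] m] n] /=; rewrite tE sE /R_coef {1}/basis_scalar dot0l oppr0 expr0z.
  by rewrite /= (wscalarD q0); ring.
- move=> [m [n|n]] nmn; last by [].
  by case: (nmn ((tt, m), n)).
Qed.

End RMatrix.

(** * The intertwining relation, entry by entry *)

Section Intertwining.
Variables (F : fieldType) (q : F) (q0 : q != 0) (r s : int) (r1 : r != -1).
Variables (f : nat -> F) (lambda : F).
Local Notation p := (q ^ (r + 1)).
Hypothesis p_nroot : forall n, p ^+ n.+1 != 1.

Local Notation C := (R_coef q r s f (qexp p) lambda).
Local Notation X := (R_comb q r s f (qexp p) lambda).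
Local Notation R_idx := (idx_R r s).
Local Notation V a b c x y z := (qmon q0 (vec a b c, vec x y z)).

(** As [p] is not a root of unity, the last factor of the denominator is nonzero and cancels. *)
Lemma qexpS n : qexp p n = - (qexp p n.+1 * (1 - p ^+ n.+1)).
Proof.
rewrite /qexp (big_nat_recr n.+1) //= exprS; have := p_nroot n.
rewrite eq_sym -subr_eq0 => n0.
by rewrite invfM mulN1r !mulNr opprK mulrA divfK.
Qed.

Lemma R_coef_neg m n : C (m, Negz n) = 0. Proof. by []. Qed.

(** [A] collects the factors common to two consecutive coefficients; what remains is two consecutive
    coefficients of the quantum exponential and the ratio of the [wscalar]. *)
Lemma R_coefS m (n : nat) : exists A k k',
  [/\ lambda * C (m, n%:Z) = A * k,
      C (m, n.+1%:Z) = A * k' * q ^ (s + 1 - (r - s - s - 1) * (m + n)%:Z) &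
      k = - (k' * (1 - q ^ ((r + 1) * n.+1%:Z)))].
Proof.
exists (f m * lambda ^+ n.+1 * wscalar q r s (m + n)), (qexp p n), (qexp p n.+1).
split.
- by rewrite /R_coef /= exprS; ring.
- by rewrite /R_coef /= addnS wscalarS //; ring.
- by rewrite [LHS]qexpS -exprz_exp.
Qed.

(** This is the comparison of coefficients in the entry (0,1). For [n = 0] the term at [n - 1]
    vanishes and the other two exponents agree; for negative [n] everything is 0. *)
Lemma R_coef_rec m n :
  C (m, n) * q ^ (- ((m%:Z + n) * (s + 1)))
  + lambda * C (m, n - 1) * q ^ (- ((m%:Z + n - 1) * (r - s)))
  = C (m, n) * q ^ (- (m%:Z * (s + 1) + n * (s - r))).
Proof.
case: n => [[|n]|n].
- rewrite !R_coef_neg mulr0 mul0r addr0; congr (_ * q ^ _); ring.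
- have -> : n.+1%:Z - 1 = n%:Z by rewrite intS addrC addKr.
  have [A [k [k' [-> -> ->]]]] := R_coefS m n.
  set E := s + 1 - _; set a := - ((m%:Z + n.+1%:Z) * (s + 1)).
  (* Once the common factor [A * q ^ (E + a)] is taken out, [k' + k = k' * q ^ ((r + 1) * n.+1)] is
     left, the recurrence of the quantum exponential. *)
  have -> : - ((m%:Z + n.+1%:Z - 1) * (r - s)) = E + a.
    by rewrite /E /a intS PoszD; ring.
  have -> : - (m%:Z * (s + 1) + n.+1%:Z * (s - r)) = a + (r + 1) * n.+1%:Z.
    by rewrite /a; ring.
  by rewrite !(expfzDr _ _ q0); ring.
- by rewrite R_coef_neg !(mul0r, mulr0) addr0.
Qed.

(** The counterpart for the entry (1,2), where the binomial multiplies from the left; the same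
    recurrence settles it. *)
Lemma R_coef_rec_tilde m n :
  C (m, n) * q ^ (- ((m%:Z + n) * (s - r)))
  = lambda * C (m, n - 1) * q ^ (m%:Z * (s + 1) - (n - 1) * (r - s))
  + C (m, n) * q ^ (- (m%:Z * (s - r) + n * (s + 1))).
Proof.
case: n => [[|n]|n].
- rewrite !R_coef_neg mulr0 mul0r add0r; congr (_ * q ^ _); ring.
- have -> : n.+1%:Z - 1 = n%:Z by rewrite intS addrC addKr.
  have [A [k [k' [-> -> ->]]]] := R_coefS m n.
  set E := s + 1 - _; set c := - (m%:Z * (s - r) + n.+1%:Z * (s + 1)).
  have -> : m%:Z * (s + 1) - n%:Z * (r - s) = E + c.
    by rewrite /E /c intS PoszD; ring.
  have -> : - ((m%:Z + n.+1%:Z) * (s - r)) = c + (r + 1) * n.+1%:Z.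
    by rewrite /c; ring.
  by rewrite !(expfzDr _ _ q0); ring.
- by rewrite R_coef_neg !(mul0r, mulr0) addr0.
Qed.

Lemma idx_R_add_inj v : injective (fun mn => (R_idx mn + v, true)).
Proof. by move=> mn mn' /(congr1 fst)/addIr/(idx_R_inj r1). Qed.

(** An extra factor [idx_w] raises the exponent [n] by one, which is a bijection of the indices
    because [n] runs over [int]. *)
Lemma comb_shift v D :
  comb (fun mn => (R_idx mn + (idx_w r s + v), true)) D
  = comb (fun mn => (R_idx mn + v, true)) (fun mn => D (mn.1, mn.2 - 1)) :> formal F.
Proof.
apply: (@comb_extend _ _ _ (fun mn => (mn.1, mn.2 + 1))).
- by move=> [m n] [m' n'] /= [-> /addIr ->].
- exact: idx_R_add_inj.
- move=> [m n]; rewrite /idx_R /= mulrzDr mulr1z.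
  by rewrite !addrA.
- by move=> [m n] /=; rewrite addrK.
- by move=> [m n] nmn; case: (nmn (m, n - 1)); rewrite /= subrK.
Qed.

Definition R_intertwines (x y : qtorus q0) : Prop :=
  [/\ fmul_defined q0 X (formal_of x), fmul_defined q0 (formal_of y) X
    & fmul q0 X (formal_of x) = fmul q0 (formal_of y) X].

(** Crossing [symF] produces [v'], and the second hypothesis says that the monomial [v'] commutes
    with every monomial in [w] and [wtilde], so both sides have the same coefficients. *)
Lemma R_comb_qmon c v v' : idx_calF v = v' ->
  (forall mn, dot (R_idx mn).2 v'.1 = dot v'.2 (R_idx mn).1) ->
  R_intertwines (c *: qmon q0 v) (c *: qmon q0 v').
Proof.
move=> vv' dv; rewrite /R_intertwines.
have [dl ->] := fmul_comb_qmon q0 C (@idx_R_inj r s r1) c v.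
have [dr ->] := fmul_qmon_comb q0 C (@idx_R_inj r s r1) c v'.
split; [exact: dl | exact: dr |].
by rewrite vv'; congr comb; apply/funext => mn; rewrite dv.
Qed.

Lemma R_comb_0 : R_intertwines 0 0.
Proof.
have v0 : idx_calF (vec 0 0 0, vec 0 0 0) = (vec 0 0 0, vec 0 0 0).
  by rewrite idx_calF_vec; apply: eq_vecs; ring.
(* Zero is treated as 0 times the unit monomial. *)
have := R_comb_qmon 0 v0; rewrite scale0r; apply=> -[m n].
by rewrite idx_RE !dot_vec; ring.
Qed.

Lemma eq_formalD (Y Y' Z Z' : formal F) : Y = Y' -> Z = Z' ->
  (fun k => Y k + Z k) = (fun k => Y' k + Z' k).
Proof. by move=> -> ->. Qed.

Lemma eq_mul_exprz (x y : F) e e' : x = y -> e = e' -> x * q ^ e = y * q ^ e'.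
Proof. by move=> -> ->. Qed.

(** After crossing [symF], the two monomials of the binomial differ by [idx_w]. A shift of [n] puts
    them on one index family, where the claim is [R_coef_rec] times [eta]. *)
Lemma R_comb_01 eta :
  R_intertwines
    (eta *: V (s + 1) 0 0 0 0 1 + (eta * lambda) *: V 0 (s + 1) (s - r) 1 0 0)
    (eta *: V (s + 1) 0 0 0 1 0).
Proof.
rewrite /R_intertwines formal_ofD.
have [d1 e1] := fmul_comb_qmon q0 C (@idx_R_inj r s r1) eta
  (vec (s + 1) 0 0, vec 0 0 1).
have [d2 e2] := fmul_comb_qmon q0 C (@idx_R_inj r s r1) (eta * lambda)
  (vec 0 (s + 1) (s - r), vec 1 0 0).
have [d3 e3] := fmul_qmon_comb q0 C (@idx_R_inj r s r1) eta
  (vec (s + 1) 0 0, vec 0 1 0).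
have [d ->] := fmulDr d1 d2.
split; [exact: d | exact: d3 |].
refine (etrans (eq_formalD e1 e2) (etrans _ (esym e3))).
have -> : idx_calF (vec (s + 1) 0 0, vec 0 0 1) = (vec (s + 1) 0 0, vec 0 1 0).
  by rewrite idx_calF_vec; apply: eq_vecs; ring.
have -> : idx_calF (vec 0 (s + 1) (s - r), vec 1 0 0)
        = idx_w r s + (vec (s + 1) 0 0, vec 0 1 0).
  by rewrite idx_calF_vec idx_vecD; apply: eq_vecs; ring.
rewrite comb_shift combD; last exact: idx_R_add_inj.
congr comb; apply/funext => -[m n].
rewrite idx_vecD !idx_RE !dot_vec /=.
have := congr1 (fun z => eta * z) (R_coef_rec m n).
rewrite (mulrDr eta) !mulrA => E.
by apply: (etrans _ (etrans E _)); [congr (_ + _)|]; apply: eq_mul_exprz; ring.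
Qed.

(** The two monomials on the left of the R-matrix already differ by [idx_w]; after the shift the
    claim is [R_coef_rec_tilde] times [eta]. *)
Lemma R_comb_12 eta :
  R_intertwines (eta *: V (s - r) 0 0 0 1 0)
    ((eta * lambda) *: V 0 (s - r) (s + 1) 1 0 0 + eta *: V (s - r) 0 0 0 0 1).
Proof.
rewrite /R_intertwines formal_ofD.
have [d1 e1] := fmul_comb_qmon q0 C (@idx_R_inj r s r1) eta
  (vec (s - r) 0 0, vec 0 1 0).
have [d2 e2] := fmul_qmon_comb q0 C (@idx_R_inj r s r1) (eta * lambda)
  (vec 0 (s - r) (s + 1), vec 1 0 0).
have [d3 e3] := fmul_qmon_comb q0 C (@idx_R_inj r s r1) eta
  (vec (s - r) 0 0, vec 0 0 1).
have [d ->] := fmulDl d2 d3.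
split; [exact: d1 | exact: d |].
refine (etrans e1 (etrans _ (esym (eq_formalD e2 e3)))).
have -> : idx_calF (vec (s - r) 0 0, vec 0 1 0) = (vec (s - r) 0 0, vec 0 0 1).
  by rewrite idx_calF_vec; apply: eq_vecs; ring.
have -> : (vec 0 (s - r) (s + 1), vec 1 0 0)
        = idx_w r s + (vec (s - r) 0 0, vec 0 0 1).
  by rewrite idx_vecD; apply: eq_vecs; ring.
rewrite comb_shift combD; last exact: idx_R_add_inj.
congr comb; apply/funext => -[m n].
rewrite idx_vecD !idx_RE !dot_vec /=.
have := congr1 (fun z => eta * z) (R_coef_rec_tilde m n).
rewrite (mulrDr eta) !mulrA => E.
by apply: (etrans _ (etrans E _)); [|congr (_ + _)]; apply: eq_mul_exprz; ring.
Qed.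

Lemma mx3_entries (Q : qtorus q0 -> qtorus q0 -> Prop)
    x00 x01 x02 x10 x11 x12 x20 x21 x22 y00 y01 y02 y10 y11 y12 y20 y21 y22 :
  Q x00 y00 -> Q x01 y01 -> Q x02 y02 -> Q x10 y10 -> Q x11 y11 -> Q x12 y12 ->
  Q x20 y20 -> Q x21 y21 -> Q x22 y22 -> forall i j,
  Q (mx3 [:: [:: x00; x01; x02]; [:: x10; x11; x12]; [:: x20; x21; x22]] i j)
    (mx3 [:: [:: y00; y01; y02]; [:: y10; y11; y12]; [:: y20; y21; y22]] i j).
Proof.
move=> Q00 Q01 Q02 Q10 Q11 Q12 Q20 Q21 Q22 i j; rewrite !mxE.
by move: i j; do 2!apply: ord3P.
Qed.

Lemma R_comb_entries eta (i j : 'I_3) :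
  R_intertwines (map_mx (psi q0 s) (Tmx q0 r lambda eta) i j)
                (map_mx (psi q0 s) (Ttmx q0 r lambda eta) i j).
Proof.
rewrite psi_TmxE psi_TtmxE.
(* The goals follow in the row order 1, 2, 0. *)
apply: (mx3_entries (Q := R_intertwines)); last 6 first.
- exact: R_comb_0.
- apply: R_comb_qmon => [|[m n]]; first by rewrite idx_calF_vec; apply: eq_vecs; ring.
  by rewrite idx_RE !dot_vec; ring.
- exact: R_comb_12.
- exact: R_comb_0.
- exact: R_comb_0.
- apply: R_comb_qmon => [|[m n]]; first by rewrite idx_calF_vec; apply: eq_vecs; ring.
  by rewrite idx_RE !dot_vec; ring.
- apply: R_comb_qmon => [|[m n]]; first by rewrite idx_calF_vec; apply: eq_vecs; ring.
  by rewrite idx_RE !dot_vec; ring.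
- exact: R_comb_01.
- apply: R_comb_qmon => [|[m n]]; first by rewrite idx_calF_vec; apply: eq_vecs; ring.
  by rewrite idx_RE !dot_vec; ring.
Qed.

End Intertwining.

(** * Specialisation to complex [q] off the unit circle *)

Theorem theorem1 (R : realType) (q : R[i]) (q0 : q != 0) (q1 : `|q| != 1)
  (r s : int) (r1 : r != -1) (lambda : R[i]) (lambda0 : lambda != 0)
  (eta : R[i]) (etaE : eta ^ (r ^+ 2 + r + 1) = lambda ^ (- r))
  (f : nat -> R[i]) (f_inv : ps_invertible f) :
  let p := q ^ (r + 1) in
  let ws := w q0 r s in
  let wts := wtilde q0 r s in
  let Ts := map_mx (psi q0 s) (Tmx q0 r lambda eta) in
  let Tts := map_mx (psi q0 s) (Ttmx q0 r lambda eta) in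
  let fwt := ps_eval f wts in
  let fw := ps_eval f ws in
  let Ew := ps_eval (qexp p) (lambda *: ws) in
  let Ewt := ps_eval (qexp p) (lambda *: wts) in
  let SF := symF R[i] in
  let mul := fmul q0 in
  let RR := mul (mul fwt Ew) SF in
  [/\ ps_eval_defined f wts, ps_eval_defined f ws,
      ps_eval_defined (qexp p) (lambda *: ws)
    & ps_eval_defined (qexp p) (lambda *: wts)] /\
  [/\ fmul_defined q0 fwt Ew, fmul_defined q0 (mul fwt Ew) SF,
      fmul_defined q0 SF fw & fmul_defined q0 (mul SF fw) Ewt] /\
  RR = mul (mul SF fw) Ewt /\
  (forall i j : 'I_3,
    [/\ fmul_defined q0 RR (formal_of (Ts i j)),
        fmul_defined q0 (formal_of (Tts i j)) RR
      & mul RR (formal_of (Ts i j)) = mul (formal_of (Tts i j)) RR]).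
Proof.
have norm_qXz z : `|q ^ z| = `|q| ^ z.
  by case: z => n; rewrite ?NegzE ?invr_expz ?exprzN ?normfV ?normrX.
(* Taking norms, a power of [q] equal to 1 with the nonzero exponent [(r + 1) * n.+1] would force
   the norm of [q] to be 1. *)
have p_nroot n : (q ^ (r + 1)) ^+ n.+1 != 1.
  apply: contraNN q1 => /eqP/(congr1 (fun z => `|z|)).
  rewrite -[_ ^+ n.+1]/((q ^ (r + 1)) ^ n.+1%:Z) exprz_exp norm_qXz normr1 => /eqP.
  by rewrite pexprz_eq1 // mulf_eq0 addr_eq0 (negPf r1).
move=> p ws wts Ts Tts fwt fw Ew Ewt SF mul RR.
have [d1 [d2 RRE]] := R_product q0 s r1 f (qexp p) lambda.
have [d3 [d4 RRE']] := R_product_tilde q0 s r1 f (qexp p) lambda.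
split; last split; last split.
- split.
  + exact: (ps_eval_comb f (idx_wt_inj r1) (wtildeX q0 r s)).1.
  + exact: (ps_eval_comb f (idx_w_inj r1) (wX q0 r s)).1.
  + exact: (ps_eval_comb _ (idx_w_inj r1) (lambda_wX q0 r s lambda)).1.
  + exact: (ps_eval_comb _ (idx_wt_inj r1) (lambda_wtildeX q0 r s lambda)).1.
- exact: And4 d1 d2 d3 d4.
- exact: etrans RRE (esym RRE').
have -> : RR = R_comb q r s f (qexp p) lambda by exact: RRE.
exact: (R_comb_entries q0 s r1 f lambda p_nroot eta).
Qed.
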